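(* There is a parallel algorithm with $O(n^2\log^2 m)$ depth and $O(nm^{n+1})$ work that, given an allocation instance with $m$ goods and $n$ agents with additive valuations and a fixed ordering $\sigma$ of the agents, outputs the allocation produced by Fixed-Order Round Robin with ordering $\sigma$ (which is $\mathsf{EF1}$).
   Context: An allocation instance has a set $M$ of $m$ goods, $n$ agents, and additive valuations $v_i:2^M\to\mathbb{R}_{\ge0}$, $v_i(S)=\sum_{g\in S}v_i(g)$. Each agent has a preference list $\pi_i$: an ordering of all goods by nonincreasing value, ties broken arbitrarily but fixed. Fixed-Order Round Robin with ordering $\sigma$: in each round the agents, in the order $\sigma$, each take their first remaining good according to their preference list, until the goods are exhausted. An allocation is $\mathsf{EF1}$ if for all agents $i,j$ there is $s\in\mathcal{A}(j)$ with $v_i(\mathcal{A}(i))\ge v_i(\mathcal{A}(j)\setminus\{s\})$. Depth and work are measured in the binary fork-join work-depth model. *)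

(* Defs.v *)
From mathcomp Require Import all_boot all_order all_fingroup all_algebra.

Set Implicit Arguments.
Unset Strict Implicit.
Unset Printing Implicit Defensive.

Import Order.TTheory GRing.Theory Num.Theory.

(** * Fair allocation and Round Robin *)

(* [v i g] is the value of the good [g] for the agent [i]. *)
Definition bundle_value (R : realFieldType) (n m : nat)
    (v : 'I_n -> 'I_m -> R) (i : 'I_n) (S : {set 'I_m}) : R :=
  (\sum_(g in S) v i g)%R.

(* An empty bundle is never envied; it offers no good [s] to remove, and the
   usual convention (no condition on it) is made explicit. *)
Definition EF1 (R : realFieldType) (n m : nat)
    (v : 'I_n -> 'I_m -> R) (A : {ffun 'I_n -> {set 'I_m}}) : Prop :=
  forall i j : 'I_n, A j <> set0 ->
    exists2 s, s \in A j &
      (bundle_value v i (A j :\ s) <= bundle_value v i (A i))%R.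

Definition pref_list (R : realFieldType) (m : nat)
    (u : 'I_m -> R) (p : seq 'I_m) : Prop :=
  perm_eq p (enum 'I_m) /\ sorted (fun g h => (u h <= u g)%R) p.

(* Among goods of equal value, [p] lists first those of smaller rank [tb]. *)
Definition breaks_ties (R : realFieldType) (m : nat)
    (u : 'I_m -> R) (tb : 'I_m -> 'I_m) (p : seq 'I_m) : Prop :=
  forall g h : 'I_m, u g = u h -> (index g p < index h p) = (tb g < tb h).

(* Every way of breaking ties is given by such a ranking. *)
Lemma pref_list_breaks_ties (R : realFieldType) (m : nat)
    (u : 'I_m -> R) (p : seq 'I_m) :
  pref_list u p -> exists tb, breaks_ties u tb p.
Proof.
move=> [pE _].
have lt_m g : index g p < m.
  by rewrite -[m in _ < m]size_enum_ord -(perm_size pE) index_mem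
             (perm_mem pE) mem_enum.
by exists (fun g => Ordinal (lt_m g)).
Qed.

(* The goods that remain, and the bundles so far. *)
Definition rr_state (n m : nat) : Type :=
  ({set 'I_m} * {ffun 'I_n -> {set 'I_m}})%type.

Definition rr_turn (n m : nat) (pi : 'I_n -> seq 'I_m)
    (st : rr_state n m) (i : 'I_n) : rr_state n m :=
  if ohead [seq g <- pi i | g \in st.1] is Some g then
    (st.1 :\ g, [ffun j => if j == i then g |: st.2 j else st.2 j])
  else st.

Definition rr_round (n m : nat) (pi : 'I_n -> seq 'I_m) (sigma : {perm 'I_n})
    (st : rr_state n m) : rr_state n m :=
  foldl (rr_turn pi) st [seq sigma k | k <- enum 'I_n].

(* For [0 < n] each round takes at least one good while some remain, so [m]
   rounds exhaust them; a turn with no remaining good does nothing. *)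
Definition round_robin (n m : nat) (pi : 'I_n -> seq 'I_m)
    (sigma : {perm 'I_n}) : {ffun 'I_n -> {set 'I_m}} :=
  (iter m (rr_round pi sigma) ([set: 'I_m], [ffun=> set0])).2.

(** * The binary fork-join work-depth model

   Every thread is a word RAM with its own registers; all threads share one
   memory.  [Par c1 c2] forks two children, each starting with a copy of the
   registers of the parent, which resumes when both have ended.  Procedures have
   no parameters and act on the registers of the calling thread; they provide
   recursion, hence unbounded nesting of forks.  A program is a fixed finite
   list of procedures. *)

Inductive binop : Type := OpAdd | OpSub | OpMul | OpDiv | OpMod | OpLt | OpEq.

Inductive expr : Type :=
| Lit of nat
| Reg of nat
| Bin of binop & expr & expr.

Inductive cmd : Type :=
| Skip
| Assign of nat & expr                (* r := e *)
| Fetch of nat & expr                 (* r := mem[e] *)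
| Store of expr & expr                (* mem[e1] := e2 *)
| Compare of nat & expr & expr & expr (* r := (v_e1(e2) <= v_e1(e3)) *)
| Seq of cmd & cmd
| If of expr & cmd & cmd
| While of expr & cmd
| Call of nat
| Par of cmd & cmd.

Definition program : Type := seq cmd.

Definition binop_sem (o : binop) (a b : nat) : nat :=
  match o with
  | OpAdd => a + b
  | OpSub => a - b
  | OpMul => a * b
  | OpDiv => a %/ b
  | OpMod => a %% b
  | OpLt => a < b
  | OpEq => a == b
  end.

(* Words have [w] bits; an arithmetic overflow makes the machine stuck. *)
Definition word (w x : nat) : option nat := if x < 2 ^ w then Some x else None.

Fixpoint eval (w : nat) (rf : nat -> nat) (e : expr) : option nat :=
  match e with
  | Lit k => word w k
  | Reg r => Some (rf r)
  | Bin o e1 e2 =>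
      if eval w rf e1 is Some a then
        if eval w rf e2 is Some b then word w (binop_sem o a b) else None
      else None
  end.

Fixpoint expr_size (e : expr) : nat :=
  if e is Bin _ e1 e2 then (expr_size e1 + expr_size e2).+1 else 1.

Record outcome : Type := Outcome {
  oregs : nat -> nat;
  omem : nat -> nat;
  oreads : seq nat;   (* addresses read *)
  owrites : seq nat;  (* addresses written *)
  owork : nat;
  odepth : nat }.

(* No address written by one child is accessed by the other, so that all
   interleavings of the two children have the same result. *)
Definition race_free (o1 o2 : outcome) : bool :=
  ~~ has (mem (owrites o1)) (oreads o2 ++ owrites o2) &&
  ~~ has (mem (owrites o2)) (oreads o1).

Definition seq_outcome (k : nat) (o1 o2 : outcome) : outcome :=
  Outcome (oregs o2) (omem o2) (oreads o1 ++ oreads o2)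
          (owrites o1 ++ owrites o2)
          (k + owork o1 + owork o2) (k + odepth o1 + odepth o2).

Definition tick (k : nat) (o : outcome) : outcome :=
  Outcome (oregs o) (omem o) (oreads o) (owrites o) (k + owork o) (k + odepth o).

Definition par_outcome (rf : nat -> nat) (o1 o2 : outcome) : outcome :=
  Outcome rf
          (fun a => if a \in owrites o1 then omem o1 a else omem o2 a)
          (oreads o1 ++ oreads o2) (owrites o1 ++ owrites o2)
          (owork o1 + owork o2).+1 (maxn (odepth o1) (odepth o2)).+1.

(* The real inputs [v] are read-only and used through comparisons only.  Every
   command costs one unit plus the number of operations in its expressions. *)
Inductive exec (R : realFieldType) (n m : nat) (v : 'I_n -> 'I_m -> R)
    (w : nat) (P : program) :
    cmd -> (nat -> nat) -> (nat -> nat) -> outcome -> Prop :=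
| exec_Skip rf M :
    exec v w P Skip rf M (Outcome rf M [::] [::] 1 1)
| exec_Assign r e rf M x of eval w rf e = Some x :
    exec v w P (Assign r e) rf M
      (Outcome [eta rf with r |-> x] M [::] [::]
               (expr_size e).+1 (expr_size e).+1)
| exec_Fetch r e rf M a of eval w rf e = Some a :
    exec v w P (Fetch r e) rf M
      (Outcome [eta rf with r |-> M a] M [:: a] [::]
               (expr_size e).+1 (expr_size e).+1)
| exec_Store e1 e2 rf M a x of
    eval w rf e1 = Some a & eval w rf e2 = Some x :
    exec v w P (Store e1 e2) rf M
      (Outcome rf [eta M with a |-> x] [::] [:: a]
               (expr_size e1 + expr_size e2).+1
               (expr_size e1 + expr_size e2).+1)
| exec_Compare r e1 e2 e3 rf M (i : 'I_n) (g h : 'I_m) of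
    eval w rf e1 = Some (i : nat) & eval w rf e2 = Some (g : nat) &
    eval w rf e3 = Some (h : nat) :
    exec v w P (Compare r e1 e2 e3) rf M
      (Outcome [eta rf with r |-> nat_of_bool (v i g <= v i h)%R] M [::] [::]
               (expr_size e1 + expr_size e2 + expr_size e3).+1
               (expr_size e1 + expr_size e2 + expr_size e3).+1)
| exec_Seq c1 c2 rf M o1 o2 of
    exec v w P c1 rf M o1 & exec v w P c2 (oregs o1) (omem o1) o2 :
    exec v w P (Seq c1 c2) rf M (seq_outcome 0 o1 o2)
| exec_If e c1 c2 rf M x o of
    eval w rf e = Some x &
    exec v w P (if x != 0 then c1 else c2) rf M o :
    exec v w P (If e c1 c2) rf M (tick (expr_size e).+1 o)
| exec_While_end e c rf M of eval w rf e = Some 0 :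
    exec v w P (While e c) rf M
      (Outcome rf M [::] [::] (expr_size e).+1 (expr_size e).+1)
| exec_While_loop e c rf M x o1 o2 of
    eval w rf e = Some x.+1 &
    exec v w P c rf M o1 &
    exec v w P (While e c) (oregs o1) (omem o1) o2 :
    exec v w P (While e c) rf M (seq_outcome (expr_size e).+1 o1 o2)
| exec_Call k c rf M o of onth P k = Some c & exec v w P c rf M o :
    exec v w P (Call k) rf M (tick 1 o)
| exec_Par c1 c2 rf M o1 o2 of
    exec v w P c1 rf M o1 & exec v w P c2 rf M o2 & race_free o1 o2 :
    exec v w P (Par c1 c2) rf M (par_outcome rf o1 o2).

(* Memory layout: cells [0, m) receive the output, the next [n] cells hold the
   ordering of the agents ([sigma k] is the agent that moves in position [k]),
   and the next [n * m] cells the tie-breaking ranks.  All other registers and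
   cells have unspecified contents. *)
Definition is_input (n m : nat) (sigma : {perm 'I_n})
    (tb : 'I_n -> 'I_m -> 'I_m) (rf M : nat -> nat) : Prop :=
  [/\ rf 0 = n, rf 1 = m,
      forall k : 'I_n, M (m + k) = sigma k &
      forall (i : 'I_n) (g : 'I_m), M (m + n + i * m + g) = tb i g].

(* Cell [g] holds the agent that receives the good [g]. *)
Definition is_output (n m : nat) (A : {ffun 'I_n -> {set 'I_m}})
    (M : nat -> nat) : Prop :=
  forall (i : 'I_n) (g : 'I_m), (g \in A i) = (M g == i).

(* Main.v *)
Require Import Defs.
From mathcomp Require Import all_boot all_order all_fingroup all_algebra zify.
From Stdlib Require Import FunctionalExtensionality.

(** The goods taken so far are always a union of prefixes of the preference
   lists, since an agent takes its first remaining good.  Hence the state between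
   two rounds is given by one prefix length for each agent, and there are at most
   [(m + 1) ^ n] states.  The effect of one round on every state is tabulated in
   parallel: each turn is a parallel minimum over the remaining goods.  Repeated
   squaring of this table gives the effect of [2 ^ k] rounds for all
   [k <= log m], and then every good finds, by binary lifting from the empty
   state, the round in which it is taken and the agent who takes it.  When
   [n > m], only the first [m] agents ever take a good, so [min n m] agents are
   enough; this keeps the number of states in [O(m ^ n)].

   For envy-freeness, fix [i] and [j].  Between a move of [i] and the next move of
   [j], the good taken by [i] is worth to [i] at least any good that [j] can take,
   so apart from the first good of [j] every good of [j] is paid for. *)

Set Implicit Arguments.
Unset Strict Implicit.
Unset Printing Implicit Defensive.

Import Order.TTheory GRing.Theory Num.Theory.

(** * Envy-freeness up to one good *)

(** Two quantities govern the costs: the number [S = m.+1 ^ N] of states, with [N = minn n m], and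
    the number [K] of binary digits of [m]. Tabulating one round takes [O(S * N * m)] work;
    everything else fits into this, since [K <= m] and [m <= S]. For the depth the squarings decide:
    a fork tree over [S <= 2 ^ (K * N)] states has height [K * N], and fewer than [K] squarings
    follow one another. Within a round the agents must move in sequence, but each move is a tree
    over the goods of depth [O(K)], so a round has depth [O(K * N)] as well.

    A prefix has [m + 1] possible lengths, and [(m + 1) ^ N] is within a constant factor of [m ^ N]
    only because [N <= m].

    The program is not given the preference lists, only comparisons of values and the tie-breaking
    ranks; the rank of a good is recovered by counting the goods that precede it.

    Races are excluded by ownership: each index of a parallel loop has its own cells, and besides
    these it reads only cells that no index writes. *)

Lemma ohead_filterP (T : eqType) (P : pred T) (p : seq T) :
  match ohead [seq x <- p | P x] with
  | Some g => P g /\ forall h, h \in p -> P h -> index g p <= index h p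
  | None => forall h, h \in p -> ~~ P h
  end.
Proof.
elim: p => [|x p IH] //=; case: ifP => Px /=.
  by split=> // h _ _; rewrite eqxx.
case: ohead IH => [g [Pg Hg]|H].
  split=> // h; rewrite inE; case: (eqVneq x g) => [E|_]; first by rewrite -E Px in Pg.
  by case: (eqVneq x h) => [<-|xh /=]; [rewrite Px | exact: Hg].
by move=> h; rewrite inE => /orP[/eqP->|/H//]; rewrite Px.
Qed.

(** Envy between two agents is affected only by their own turns, so a round is cut into these two
    turns and three blocks of other agents. *)
Lemma split_pair (T : eqType) (x y : T) (l : seq T) :
  uniq l -> x \in l -> y \in l -> x != y ->
  exists l1 l2 l3,
    [/\ l = l1 ++ x :: l2 ++ y :: l3 \/ l = l1 ++ y :: l2 ++ x :: l3,
        x \notin l1 ++ l2 ++ l3 & y \notin l1 ++ l2 ++ l3].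
Proof.
move=> + /splitPr xl; case: xl => l1 l2 /= u yl xy.
rewrite mem_cat inE eq_sym (negbTE xy) /= in yl.
case/orP: yl u => /splitPr[p q] u.
- exists p, q, l2; rewrite -catA /= in u *; split; first by right.
  + apply/count_memPn; have := count_uniq_mem x u.
    by rewrite !count_cat /= !count_cat /= eqxx; lia.
  + apply/count_memPn; have := count_uniq_mem y u.
    by rewrite !count_cat /= !count_cat /= eqxx; lia.
- exists l1, p, q; split; first by left.
  + apply/count_memPn; have := count_uniq_mem x u.
    by rewrite !count_cat /= !count_cat /= eqxx; lia.
  + apply/count_memPn; have := count_uniq_mem y u.
    by rewrite !count_cat /= !count_cat /= eqxx; lia.
Qed.

Section RoundRobin.

Context (R : realFieldType) (n m : nat) (v : 'I_n -> 'I_m -> R).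
Context (pi : 'I_n -> seq 'I_m) (sigma : {perm 'I_n}).
Hypothesis pi_pref : forall i, pref_list (v i) (pi i).

Lemma mem_pi i g : g \in pi i.
Proof. by have [/perm_mem-> _] := pi_pref i; rewrite mem_enum. Qed.

Definition give (st : rr_state n m) (i : 'I_n) (g : 'I_m) : rr_state n m :=
  (st.1 :\ g, [ffun j => if j == i then g |: st.2 j else st.2 j]).

Variant turn_spec (st : rr_state n m) (i : 'I_n) : rr_state n m -> Prop :=
| TurnNone of st.1 = set0 : turn_spec st i st
| TurnPick g of g \in st.1 &
    (forall h, h \in st.1 -> index g (pi i) <= index h (pi i)) :
    turn_spec st i (give st i g).

Lemma rr_turnP st i : turn_spec st i (rr_turn pi st i).
Proof.
rewrite /rr_turn.
have := ohead_filterP [pred x | x \in st.1] (pi i); rewrite /=.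
case: ohead => [g [gin Hg]|H].
  by apply: TurnPick => // h hin; apply: Hg; rewrite // mem_pi.
apply: TurnNone; apply/setP => h; rewrite inE; exact/negbTE/H/mem_pi.
Qed.

Lemma index_pref_le i g h : index g (pi i) <= index h (pi i) -> (v i h <= v i g)%R.
Proof.
have [_ srt] := pi_pref i.
have tr : transitive (fun g h => (v i h <= v i g)%R).
  by move=> y x z /= xy yz; exact: le_trans yz xy.
have rf : reflexive (fun g h => (v i h <= v i g)%R) by move=> x /=.
by apply: (sorted_leq_index tr rf srt); rewrite ?mem_pi.
Qed.

(** * The envy of one agent for another along a run *)

Section Envy.

Hypothesis v_ge0 : forall i g, (0 <= v i g)%R.
Variables i j : 'I_n.
Hypothesis ij : i != j.

Local Notation val := (bundle_value v i).

Lemma bundle_value_ge0 (A : {set 'I_m}) : (0 <= val A)%R.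
Proof. by apply: sumr_ge0 => g _; apply: v_ge0. Qed.

Lemma bundle_valueU1 g (A : {set 'I_m}) : g \notin A -> val (g |: A) = (v i g + val A)%R.
Proof. by move=> gA; rewrite /bundle_value big_setU1. Qed.

Definition bundles_disjoint (st : rr_state n m) : Prop :=
  forall k g, g \in st.2 k -> g \notin st.1.

(* The two phases of the envy of [i] for [j]: [ahead] holds when [i] has moved
   since the last move of [j] (or [j] has not moved), and then leaves room for
   any pick of [j]. *)
Definition level (st : rr_state n m) : Prop :=
  st.2 j = set0 \/
  exists2 s, s \in st.2 j & (val (st.2 j :\ s) <= val (st.2 i))%R.

Definition ahead (st : rr_state n m) : Prop :=
  st.2 j = set0 \/
  exists2 s, s \in st.2 j & (val (st.2 j :\ s) <= val (st.2 i))%R /\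
    forall g, g \in st.1 -> (val (st.2 j :\ s) + v i g <= val (st.2 i))%R.

Lemma ahead_level st : ahead st -> level st.
Proof. by case=> [|[s sj []]]; [left|right; exists s]. Qed.

Lemma turn_disjoint st k : bundles_disjoint st -> bundles_disjoint (rr_turn pi st k).
Proof.
move=> D; case: rr_turnP => // g gin _ l h /=; rewrite ffunE.
case: ifP => _; rewrite !inE; last by move=> /D/negbTE->; rewrite andbF.
by case: (eqVneq h g) => //= _ /D.
Qed.

Lemma turn_other st k : k != i -> k != j ->
  (level st -> level (rr_turn pi st k)) /\ (ahead st -> ahead (rr_turn pi st k)).
Proof.
rewrite ![k == _]eq_sym => ki kj; case: rr_turnP => // g gin _.
rewrite /level /ahead /= !ffunE (negbTE ki) (negbTE kj); split=> //.
case=> [|[s sj [H1 H2]]]; first by left.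
by right; exists s => //; split=> // h; rewrite !inE => /andP[_ /H2].
Qed.

(** The good that [i] picks is worth to [i] at least any good that remains, and its value is exactly
    the room that the next pick of [j] may use up. *)
Lemma turn_i st : bundles_disjoint st -> level st -> ahead (rr_turn pi st i).
Proof.
move=> D [|[s sj H]].
  by case: rr_turnP => [_ ?|g _ _ H]; left => //=; rewrite ffunE eq_sym (negbTE ij).
case: rr_turnP => [E|g gin Hg]; right; exists s => //=.
- by split=> // g; rewrite E inE.
- by rewrite ffunE eq_sym (negbTE ij).
rewrite !ffunE eqxx eq_sym (negbTE ij).
have gi : g \notin st.2 i by apply: contraL gin => /D.
rewrite (bundle_valueU1 gi); split.
  by apply: le_trans H _; rewrite lerDr.
move=> h; rewrite !inE => /andP[_ hin]; rewrite addrC lerD //.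
exact/index_pref_le/Hg.
Qed.

(** The first good of [j] becomes the exempted good [s]; each later one consumes the room left by
    [ahead]. *)
Lemma turn_j st : bundles_disjoint st -> ahead st -> level (rr_turn pi st j).
Proof.
move=> D A; case: rr_turnP => [_|g gin _]; first exact: ahead_level.
right; rewrite /= !ffunE eqxx (negbTE ij).
have gj : g \notin st.2 j by apply: contraL gin => /D.
case: A => [->|[s sj [H1 H2]]].
  exists g; first by rewrite !inE eqxx.
  by rewrite setU0 setDv /bundle_value big_set0 bundle_value_ge0.
exists s; first by rewrite !inE sj orbT.
have gs : g != s by apply: contraNneq gj => ->.
rewrite setDUl (_ : [set g] :\ s = [set g]); last first.
  by apply/setP => x; rewrite !inE; case: (eqVneq x g) => [->|]; rewrite ?gs ?andbF.
rewrite bundle_valueU1 ?inE ?negb_and ?gj ?orbT // addrC; exact: H2.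
Qed.

Lemma fold_other l st : i \notin l -> j \notin l -> bundles_disjoint st ->
  let st' := foldl (rr_turn pi) st l in
  [/\ bundles_disjoint st', level st -> level st' & ahead st -> ahead st'].
Proof.
elim: l st => [|k l IH] st //=; rewrite !inE !negb_or => /andP[ik il] /andP[jk jl] D.
have [D' L A] := IH (rr_turn pi st k) il jl (turn_disjoint (k := k) D).
rewrite eq_sym in ik; rewrite eq_sym in jk.
by have [L' A'] := turn_other st ik jk; split=> // [/L'/L|/A'/A].
Qed.

(** The invariant between rounds depends on who moves first: it is [level] if [i] precedes [j] in
    [l], and [ahead] if [j] precedes [i]. Both hold initially because the bundle of [j] is empty. *)
Lemma fold_round l : uniq l -> i \in l -> j \in l ->
  exists2 inv : rr_state n m -> Prop,
    inv ([set: 'I_m], [ffun=> set0]) /\ (forall st, inv st -> level st) &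
    forall st, bundles_disjoint st -> inv st ->
      bundles_disjoint (foldl (rr_turn pi) st l) /\ inv (foldl (rr_turn pi) st l).
Proof.
move=> ul il jl; have [l1 [l2 [l3 [E ni nj]]]] := split_pair ul il jl ij.
move: ni nj; rewrite !mem_cat !negb_or => /and3P[i1 i2 i3] /and3P[j1 j2 j3].
case: E => ->; [exists level|exists ahead] => //.
- by split=> //; left; rewrite ffunE.
- move=> st D I; rewrite foldl_cat /= foldl_cat /=.
  have [D1 L1 _] := fold_other i1 j1 D; move/L1: I => I.
  have [D2 _ L2] := fold_other i2 j2 (turn_disjoint (k := i) D1).
  have I2 := L2 (turn_i D1 I).
  have [D3 L3 _] := fold_other i3 j3 (turn_disjoint (k := j) D2).
  by split=> //; apply/L3/turn_j.
- by split; [left; rewrite ffunE | exact: ahead_level].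
- move=> st D I; rewrite foldl_cat /= foldl_cat /=.
  have [D1 _ L1] := fold_other i1 j1 D; move/L1: I => I.
  have [D2 L2 _] := fold_other i2 j2 (turn_disjoint (k := j) D1).
  have I2 := L2 (turn_j D1 I).
  have [D3 _ L3] := fold_other i3 j3 (turn_disjoint (k := i) D2).
  by split=> //; apply/L3/turn_i.
Qed.

Lemma round_robin_level :
  level (iter m (rr_round pi sigma) ([set: 'I_m], [ffun=> set0])).
Proof.
have ul : uniq [seq sigma k | k <- enum 'I_n].
  by rewrite map_inj_uniq ?enum_uniq //; exact: perm_inj.
have al k : k \in [seq sigma k | k <- enum 'I_n].
  by apply/mapP; exists (sigma^-1 k)%g; rewrite ?mem_enum ?permKV.
have [inv [I0 IL] IS] := fold_round ul (al i) (al j).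
set st0 := (_, _) in I0 *.
have D0 : bundles_disjoint st0 by move=> k g; rewrite /= ffunE inE.
suff H t : bundles_disjoint (iter t (rr_round pi sigma) st0) /\
           inv (iter t (rr_round pi sigma) st0) by have [_ /IL] := H m.
by elim: t => [//|t [D I]] /=; exact: IS.
Qed.

End Envy.

Lemma round_robin_EF1 : (forall i g, (0 <= v i g)%R) -> EF1 v (round_robin pi sigma).
Proof.
move=> v0 i j /eqP Aj; have [Eij|ij] := eqVneq i j.
  rewrite -Eij in Aj *; have /set0Pn[s si] := Aj; exists s => //.
  by rewrite /bundle_value [leRHS](big_setD1 s) //= lerDr.
have [E|[s sj H]] := round_robin_level v0 ij; first by rewrite /round_robin E eqxx in Aj.
by exists s.
Qed.

End RoundRobin.

(** * Cost and footprint of programs *)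

Definition upd (f : nat -> nat) (r x : nat) : nat -> nat :=
  fun q => if eqn q r then x else f q.

Lemma upd_eq f r x : upd f r x r = x.
Proof. by rewrite /upd (introT eqnP (erefl r)). Qed.

Lemma upd_neq f r x q : q <> r -> upd f r x q = f q.
Proof. by rewrite /upd; case: eqnP. Qed.

Lemma upd_upd f r x y : upd (upd f r x) r y = upd f r y.
Proof. by apply: functional_extensionality => q; rewrite /upd; case: eqnP. Qed.

Lemma updC f r r' x y : r <> r' -> upd (upd f r x) r' y = upd (upd f r' y) r x.
Proof.
move=> ne; apply: functional_extensionality => q; rewrite /upd.
by case: eqnP => // ->; case: eqnP => // e; case: ne.
Qed.

(** A second name for [upd], so that unfolding register updates leaves memory updates folded. *)
Definition mset : (nat -> nat) -> nat -> nat -> nat -> nat := upd.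

Lemma mset_eq M a x b : b = a -> mset M a x b = x.
Proof. by move->; exact: upd_eq. Qed.

Lemma mset_neq M a x b : b <> a -> mset M a x b = M b.
Proof. exact: upd_neq. Qed.

Fixpoint eval_nat (rf : nat -> nat) (e : expr) : nat :=
  match e with
  | Lit k => k
  | Reg r => rf r
  | Bin o e1 e2 => binop_sem o (eval_nat rf e1) (eval_nat rf e2)
  end.

(** A sufficient condition against overflow. Only sums and products need a bound on the result:
    differences, quotients and remainders do not exceed their first operand, and comparisons yield
    at most 1. *)
Fixpoint eval_below (B : nat) (rf : nat -> nat) (e : expr) : Prop :=
  match e with
  | Lit k => k <= B
  | Reg r => True
  | Bin o e1 e2 => [/\ eval_below B rf e1, eval_below B rf e2 &
      match o with
      | OpAdd | OpMul => binop_sem o (eval_nat rf e1) (eval_nat rf e2) <= B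
      | OpSub | OpDiv | OpMod => eval_nat rf e1 <= B
      | _ => True
      end]
  end.

Lemma evalE w B rf e : 0 < B -> B < 2 ^ w -> eval_below B rf e ->
  eval w rf e = Some (eval_nat rf e).
Proof.
move=> B0 Bw; elim: e => [k|r|o e1 IH1 e2 IH2] //=.
  by move=> kB; rewrite /word (leq_ltn_trans kB Bw).
case=> /IH1-> /IH2-> H; rewrite /word.
suff le : binop_sem o (eval_nat rf e1) (eval_nat rf e2) <= B.
  by rewrite (leq_ltn_trans le Bw).
case: o H => //= H.
- exact: leq_trans (leq_subr _ _) H.
- exact: leq_trans (leq_div _ _) H.
- exact: leq_trans (leq_mod _ _) H.
- exact: leq_trans (leq_b1 _) B0.
- exact: leq_trans (leq_b1 _) B0.
Qed.

(* Running [c] next to an idle thread restores the registers of the parent: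
   [scoped c] has no effect on the caller but through the memory. *)
Definition scoped (c : cmd) : cmd := Par c Skip.

(** The body is scoped so that it cannot disturb the counter; iterations communicate through the
    memory alone. *)
Definition for_loop (r : nat) (bound : expr) (c : cmd) : cmd :=
  scoped (Seq (Assign r (Lit 0))
    (While (Bin OpLt (Reg r) bound)
       (Seq (scoped c) (Assign r (Bin OpAdd (Reg r) (Lit 1)))))).

(* Procedure number [k], acting in parallel on the [rn] indices from [rl] on:
   [leaf] treats one index, [comb] merges the results of the two halves. *)
Definition tree_proc (k rl rn : nat) (leaf comb : cmd) : cmd :=
  If (Bin OpLt (Reg rn) (Lit 2)) (scoped leaf)
    (Seq
      (Par (Seq (Assign rn (Bin OpDiv (Reg rn) (Lit 2))) (Call k))
           (Seq (Assign rl (Bin OpAdd (Reg rl) (Bin OpDiv (Reg rn) (Lit 2))))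
           (Seq (Assign rn (Bin OpSub (Reg rn) (Bin OpDiv (Reg rn) (Lit 2))))
                (Call k))))
      (scoped comb)).

Definition tree_call (k rl rn : nat) (bound : expr) : cmd :=
  scoped (Seq (Assign rn bound) (Seq (Assign rl (Lit 0)) (Call k))).

(** * Proof rules for work, depth and memory footprint *)

Section Wp.

Context (R : realFieldType) (n m : nat) (v : 'I_n -> 'I_m -> R).
Context (w : nat) (P : program) (B : nat).
Hypotheses (B2 : 2 <= B) (Bw : B < 2 ^ w).

Let B0 : 0 < B. Proof. exact: ltnW. Qed.

Lemma exec_frame c rf M o : exec v w P c rf M o ->
  forall a, a \notin owrites o -> omem o a = M a.
Proof.
elim=> {c rf M o} //=.
- by move=> e1 e2 rf M a x _ _ b; rewrite inE => /negbTE->.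
- move=> c1 c2 rf M o1 o2 _ IH1 _ IH2 a.
  by rewrite mem_cat negb_or => /andP[/IH1<- /IH2->].
- move=> e c rf M x o1 o2 _ _ IH1 _ IH2 a.
  by rewrite mem_cat negb_or => /andP[/IH1<- /IH2->].
- move=> c1 c2 rf M o1 o2 _ IH1 _ IH2 _ a.
  by rewrite mem_cat negb_or => /andP[/negbTE-> /IH2->].
Qed.

(* [Q] receives the final registers and memory, the work and the depth; all
   writes go to [Wr] and all reads to [Sh] or [Wr]. *)
Definition wp (c : cmd) (rf M : nat -> nat) (Sh Wr : nat -> Prop)
    (Q : (nat -> nat) -> (nat -> nat) -> nat -> nat -> Prop) : Prop :=
  exists o, [/\ exec v w P c rf M o,
    forall a, a \in oreads o -> Sh a \/ Wr a,
    forall a, a \in owrites o -> Wr a &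
    Q (oregs o) (omem o) (owork o) (odepth o)].

(** Cells outside [Wr] are unchanged, and this is offered to whoever derives [Q']; specifications
    therefore need no frame clause of their own. *)
Lemma wp_conseq c rf M (Sh Wr Sh' Wr' : nat -> Prop) Q (Q' : _ -> _ -> _ -> _ -> Prop) :
  wp c rf M Sh Wr Q ->
  (forall a, Wr a -> Wr' a) -> (forall a, Sh a -> Sh' a \/ Wr' a) ->
  (forall rf' M' wk dp, (forall a, ~ Wr a -> M' a = M a) ->
     Q rf' M' wk dp -> Q' rf' M' wk dp) ->
  wp c rf M Sh' Wr' Q'.
Proof.
move=> [o [ex Hr Hw HQ]] sW sS sQ; exists o; split=> //.
- by move=> a /Hr[/sS//|/sW]; right.
- by move=> a /Hw/sW.
apply: sQ HQ => a nW; apply: (exec_frame ex); apply/negP => /Hw; exact: nW.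
Qed.

Lemma wp_post c rf M Sh Wr Q (Q' : _ -> _ -> _ -> _ -> Prop) :
  wp c rf M Sh Wr Q ->
  (forall rf' M' wk dp, (forall a, ~ Wr a -> M' a = M a) ->
     Q rf' M' wk dp -> Q' rf' M' wk dp) ->
  wp c rf M Sh Wr Q'.
Proof. by move=> H sQ; apply: (wp_conseq H) => // a; left. Qed.

Lemma wp_skip rf M Sh Wr (Q : _ -> _ -> _ -> _ -> Prop) :
  Q rf M 1 1 -> wp Skip rf M Sh Wr Q.
Proof. by move=> HQ; eexists; split; first exact: exec_Skip. Qed.

Lemma wp_assign r e rf M Sh Wr x (Q : _ -> _ -> _ -> _ -> Prop) :
  eval_below B rf e -> eval_nat rf e = x ->
  Q (upd rf r x) M (expr_size e).+1 (expr_size e).+1 ->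
  wp (Assign r e) rf M Sh Wr Q.
Proof.
move=> /(evalE B0 Bw) He <- HQ.
by eexists; split; first exact: (exec_Assign _ _ _ _ He).
Qed.

Arguments wp_assign {r e rf M Sh Wr} x {Q}.

Lemma wp_fetch r e rf M (Sh Wr : nat -> Prop) a x (Q : _ -> _ -> _ -> _ -> Prop) :
  eval_below B rf e -> eval_nat rf e = a -> M a = x -> Sh a \/ Wr a ->
  Q (upd rf r x) M (expr_size e).+1 (expr_size e).+1 ->
  wp (Fetch r e) rf M Sh Wr Q.
Proof.
move=> /(evalE B0 Bw) He Ea <- Ha HQ; rewrite Ea in He.
eexists; split; first exact: (exec_Fetch _ _ _ _ He).
- by move=> c /=; rewrite inE => /eqP->.
- by [].
- by [].
Qed.

Lemma wp_store e1 e2 rf M Sh (Wr : nat -> Prop) a x (Q : _ -> _ -> _ -> _ -> Prop) :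
  eval_below B rf e1 -> eval_below B rf e2 ->
  eval_nat rf e1 = a -> eval_nat rf e2 = x -> Wr a ->
  Q rf (mset M a x) (expr_size e1 + expr_size e2).+1 (expr_size e1 + expr_size e2).+1 ->
  wp (Store e1 e2) rf M Sh Wr Q.
Proof.
move=> /(evalE B0 Bw) He1 /(evalE B0 Bw) He2 Ea Ex Ha HQ.
rewrite Ea in He1; rewrite Ex in He2.
eexists; split; first exact: (exec_Store _ _ _ He1 He2).
- by [].
- by move=> c /=; rewrite inE => /eqP->.
- by [].
Qed.

Lemma wp_compare r e1 e2 e3 rf M Sh Wr (i : 'I_n) (g h : 'I_m)
    (Q : _ -> _ -> _ -> _ -> Prop) :
  eval_below B rf e1 -> eval_below B rf e2 -> eval_below B rf e3 ->
  eval_nat rf e1 = i -> eval_nat rf e2 = g -> eval_nat rf e3 = h ->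
  Q (upd rf r (v i g <= v i h)%R) M
    (expr_size e1 + expr_size e2 + expr_size e3).+1
    (expr_size e1 + expr_size e2 + expr_size e3).+1 ->
  wp (Compare r e1 e2 e3) rf M Sh Wr Q.
Proof.
move=> /(evalE B0 Bw) He1 /(evalE B0 Bw) He2 /(evalE B0 Bw) He3 E1 E2 E3 HQ.
rewrite E1 in He1; rewrite E2 in He2; rewrite E3 in He3.
by eexists; split; first exact: (exec_Compare _ _ _ _ He1 He2 He3).
Qed.

Lemma wp_seq c1 c2 rf M Sh Wr Q :
  wp c1 rf M Sh Wr (fun rf1 M1 w1 d1 =>
    wp c2 rf1 M1 Sh Wr (fun rf2 M2 w2 d2 => Q rf2 M2 (w1 + w2) (d1 + d2))) ->
  wp (Seq c1 c2) rf M Sh Wr Q.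
Proof.
move=> [o1 [ex1 r1 w1 [o2 [ex2 r2 w2 HQ]]]].
exists (seq_outcome 0 o1 o2); split=> //=; first exact: exec_Seq.
- by move=> a; rewrite mem_cat => /orP[/r1|/r2].
- by move=> a; rewrite mem_cat => /orP[/w1|/w2].
Qed.

Lemma wp_if e c1 c2 rf M Sh Wr Q :
  eval_below B rf e ->
  wp (if eval_nat rf e != 0 then c1 else c2) rf M Sh Wr
    (fun rf' M' wk dp => Q rf' M' ((expr_size e).+1 + wk) ((expr_size e).+1 + dp)) ->
  wp (If e c1 c2) rf M Sh Wr Q.
Proof.
move=> /(evalE B0 Bw) He [o [ex Hr Hw HQ]].
by exists (tick (expr_size e).+1 o); split=> //; exact: exec_If He ex.
Qed.

Lemma wp_call k c rf M Sh Wr Q :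
  onth P k = Some c ->
  wp c rf M Sh Wr (fun rf' M' wk dp => Q rf' M' wk.+1 dp.+1) ->
  wp (Call k) rf M Sh Wr Q.
Proof.
move=> Hk [o [ex Hr Hw HQ]].
by exists (tick 1 o); split=> //; exact: exec_Call Hk ex.
Qed.

(** The depth of the fork is [(maxn d 1).+1] for a child of depth [d], which is only bounded by
    [d.+2]; hence the condition that [Q] is monotone in the costs. *)
Lemma wp_scoped c rf M Sh Wr Q :
  wp c rf M Sh Wr (fun _ M' wk dp => Q rf M' wk.+2 dp.+2) ->
  (forall M' wk wk' dp dp', wk' <= wk -> dp' <= dp -> Q rf M' wk dp -> Q rf M' wk' dp') ->
  wp (scoped c) rf M Sh Wr Q.
Proof.
move=> [o [ex Hr Hw HQ]] Qm.
have Hp : exec v w P (scoped c) rf M (par_outcome rf o (Outcome rf M [::] [::] 1 1)).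
  apply: exec_Par => //; first exact: exec_Skip.
  by rewrite /race_free /= -all_predC; apply/allP.
eexists; split; first exact: Hp.
- by move=> a /=; rewrite cats0 => /Hr.
- by move=> a /=; rewrite cats0 => /Hw.
have EM : omem (par_outcome rf o (Outcome rf M [::] [::] 1 1)) = omem o.
  apply: functional_extensionality => a /=.
  by case: ifPn => // /(exec_frame ex)->.
rewrite EM /=; apply: Qm HQ; lia.
Qed.

Lemma wp_while_end e c rf M Sh Wr (Q : _ -> _ -> _ -> _ -> Prop) :
  eval_below B rf e -> eval_nat rf e = 0 ->
  Q rf M (expr_size e).+1 (expr_size e).+1 -> wp (While e c) rf M Sh Wr Q.
Proof.
move=> /(evalE B0 Bw) He E0 HQ; rewrite E0 in He.
by eexists; split; first exact: (exec_While_end _ _ _ _ He).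
Qed.

Lemma wp_while_loop e c rf M Sh Wr Q :
  eval_below B rf e -> eval_nat rf e != 0 ->
  wp c rf M Sh Wr (fun rf1 M1 w1 d1 =>
    wp (While e c) rf1 M1 Sh Wr (fun rf2 M2 w2 d2 =>
      Q rf2 M2 ((expr_size e).+1 + w1 + w2) ((expr_size e).+1 + d1 + d2))) ->
  wp (While e c) rf M Sh Wr Q.
Proof.
move=> /(evalE B0 Bw) He; case E: (eval_nat rf e) => [//|x] _; rewrite E in He.
move=> [o1 [ex1 r1 w1 [o2 [ex2 r2 w2 HQ]]]].
eexists; split; first exact: (exec_While_loop He ex1 ex2).
- by move=> a; rewrite mem_cat => /orP[/r1|/r2].
- by move=> a; rewrite mem_cat => /orP[/w1|/w2].
- by [].
Qed.

Lemma wp_for r bound c rf M (Sh Wr : nat -> Prop) N (Inv : nat -> (nat -> nat) -> Prop) Wb Db :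
  N < B ->
  (forall k, eval_below B (upd rf r k) bound /\ eval_nat (upd rf r k) bound = N) ->
  Inv 0 M ->
  (forall k Mx, k < N -> Inv k Mx -> (forall a, ~ Wr a -> Mx a = M a) ->
    wp c (upd rf r k) Mx Sh Wr
       (fun _ M' wk dp => [/\ Inv k.+1 M', wk <= Wb & dp <= Db])) ->
  wp (for_loop r bound c) rf M Sh Wr
    (fun rf' M' wk dp => [/\ rf' = rf, Inv N M',
       wk <= (N.+1) * (Wb + expr_size bound + 20) &
       dp <= (N.+1) * (Db + expr_size bound + 20)]).
Proof.
move=> NB Hb I0 Hc; set X := expr_size bound.
apply: wp_scoped; last first.
  move=> M' wk wk' dp dp' l1 l2 [? ? ? ?]; split=> //; by [exact: leq_trans l1 _|exact: leq_trans l2 _].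
apply/wp_seq/(wp_assign 0) => //=.
(* Induction on the number [t] of iterations left; the additive term pays for the last, failing
   test. *)
have L : forall t k Mx, k + t = N -> Inv k Mx -> (forall a, ~ Wr a -> Mx a = M a) ->
  wp (While (Bin OpLt (Reg r) bound)
       (Seq (scoped c) (Assign r (Bin OpAdd (Reg r) (Lit 1))))) (upd rf r k) Mx Sh Wr
    (fun _ M' wk dp => [/\ Inv N M', wk <= t * (Wb + X + 20) + X + 3 &
                          dp <= t * (Db + X + 20) + X + 3]).
  elim=> [|t IH] k Mx kN Ik HM.
    rewrite addn0 in kN; subst k; have [H1 H2] := Hb N.
    have Ew : eval w (upd rf r N) (Bin OpLt (Reg r) bound) = Some 0.
      by rewrite (evalE B0 Bw) /= ?H2 ?upd_eq ?ltnn.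
    eexists; split; first exact: (exec_While_end _ _ _ _ Ew).
    + by [].
    + by [].
    + by split=> //=; rewrite -/X; lia.
  have kl : k < N by lia.
  have [H1 H2] := Hb k.
  have Ew : eval w (upd rf r k) (Bin OpLt (Reg r) bound) = Some 1.
    by rewrite (evalE B0 Bw) /= ?H2 ?upd_eq ?kl.
  have Hbody : wp (Seq (scoped c) (Assign r (Bin OpAdd (Reg r) (Lit 1))))
      (upd rf r k) Mx Sh Wr (fun rf' M' wk dp =>
        [/\ Inv k.+1 M', wk <= Wb + 6, dp <= Db + 6 & rf' = upd rf r k.+1]).
    apply: wp_seq; apply: wp_scoped; last first.
      move=> M' wk wk' dp dp' l1 l2 [o [ex Hr Hw [Q1 Q2 Q3 Q4]]]; exists o; split=> //; split=> //; lia.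
    apply: (wp_post (Hc k Mx kl Ik HM)) => rf' M' wk dp _ [I' lw ld].
    apply: (wp_assign k.+1); rewrite /= ?upd_eq ?addn1 //.
      by split=> //; apply: leq_trans _ (ltnW NB).
    by split=> //; rewrite ?upd_upd //; lia.
  have [o1 [ex1 r1 w1 [I1 lw1 ld1 E1]]] := Hbody.
  have F1 := exec_frame ex1.
  have HM1 a : ~ Wr a -> omem o1 a = M a.
    by move=> nW; rewrite F1 ?HM //; apply/negP => /w1.
  have [o2 [ex2 r2 w2 [I2 lw2 ld2]]] := IH k.+1 (omem o1) (etrans (addSnnS _ _) kN) I1 HM1.
  rewrite -E1 in ex2.
  eexists; split; first exact: (exec_While_loop Ew ex1 ex2).
  + by move=> a; rewrite mem_cat => /orP[/r1|/r2].
  + by move=> a; rewrite mem_cat => /orP[/w1|/w2].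
  + split=> //=; rewrite -/X.
      by rewrite mulSn; lia.
    by rewrite mulSn; lia.
apply: (wp_post (L N 0 M (erefl _) I0 (fun _ _ => erefl))) => rf' M' wk dp _ [I' lw ld].
split=> //; rewrite -/X mulSn; lia.
Qed.

Definition footprint (F : nat -> nat -> Prop) (lo len a : nat) : Prop :=
  exists2 i, lo <= i < lo + len & F i a.

Lemma footprint_sub F lo len lo' len' a : lo' <= lo -> lo + len <= lo' + len' ->
  footprint F lo len a -> footprint F lo' len' a.
Proof. by move=> l1 l2 [i Hi Fi]; exists i => //; lia. Qed.

(** * Divide and conquer by binary forking *)

Section Tree.

Context (k rl rn : nat) (leaf comb : cmd) (rf M : nat -> nat) (tot : nat).
Context (Sh : nat -> Prop) (Wr : nat -> nat -> Prop).
Context (Post : nat -> nat -> (nat -> nat) -> Prop) (Wl Dl Wc Dc : nat).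
Hypotheses (Pk : onth P k = Some (tree_proc k rl rn leaf comb)) (rlrn : rl <> rn).
Hypothesis totB : tot <= B.
Hypothesis Wr_inj : forall i i' a, i < tot -> i' < tot -> Wr i a -> Wr i' a -> i = i'.
Hypothesis Wr_Sh : forall i a, i < tot -> Wr i a -> ~ Sh a.
Hypothesis Post_local : forall lo len M1 M2, 0 < len -> lo + len <= tot ->
  (forall a, footprint Wr lo len a -> M1 a = M2 a) ->
  Post lo len M1 -> Post lo len M2.

Let rfn lo len := upd (upd rf rl lo) rn len.

Hypothesis leafP : forall i, i < tot ->
  wp leaf (rfn i 1) M Sh (Wr i)
    (fun _ M' wk dp => [/\ Post i 1 M', wk <= Wl & dp <= Dl]).
Hypothesis combP : forall lo l1 l2 M1, 0 < l1 -> 0 < l2 -> lo + (l1 + l2) <= tot ->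
  l1 = (l1 + l2) %/ 2 ->
  (forall a, ~ footprint Wr lo (l1 + l2) a -> M1 a = M a) ->
  Post lo l1 M1 -> Post (lo + l1) l2 M1 ->
  wp comb (rfn lo (l1 + l2)) M1 Sh (footprint Wr lo (l1 + l2))
    (fun _ M' wk dp => [/\ Post lo (l1 + l2) M', wk <= Wc & dp <= Dc]).

(** A tree with [len] leaves has [len - 1] inner nodes; keeping the charge of one node in reserve
    ([wk + (Wc + 30)]) makes the work bound additive over the two halves. The exponent [e] bounds
    the height. The halves do not race by [Wr_inj] and [Wr_Sh], and [Post_local] carries the result
    of each half over to the merged memory. *)
Lemma wp_tree_rec e lo len : 0 < len -> len <= 2 ^ e -> lo + len <= tot ->
  wp (Call k) (rfn lo len) M Sh (footprint Wr lo len)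
    (fun rf' M' wk dp => [/\ rf' = rfn lo len, Post lo len M',
       wk + (Wc + 30) <= len * (Wl + Wc + 40) & dp <= e * (Dc + 30) + Dl + 10]).
Proof.
elim: e lo len => [|e IH] lo len len0 lene loT.
  have E : len = 1 by lia.
  subst len.
  apply: (wp_call Pk); apply: wp_if => /=; first by [].
  rewrite /rfn upd_eq /= -/(rfn lo 1); apply: wp_scoped; last first.
    by move=> M' wk wk' dp dp' ? ? [? ? ? ?]; split=> //; lia.
  apply: (wp_conseq (leafP (i := lo) _)).
  - lia.
  - by move=> a; exists lo => //; lia.
  - by move=> a; left.
  by move=> rf' M' wk dp _ [H1 H2 H3]; split=> //; lia.
apply: (wp_call Pk).
have E2 : (rfn lo len) rn = len by rewrite /rfn upd_eq.
have E1 : (rfn lo len) rl = lo by rewrite /rfn upd_neq ?upd_eq.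
apply: wp_if => /=; first by [].
rewrite E2 eqb0 negbK; case: ltnP => [l2|l2].
  have E : len = 1 by lia.
  subst len.
  apply: wp_scoped; last first.
    by move=> M' wk wk' dp dp' ? ? [? ? ? ?]; split=> //; lia.
  apply: (wp_conseq (leafP (i := lo) _)).
  - lia.
  - by move=> a; exists lo => //; lia.
  - by move=> a; left.
  by move=> rf' M' wk dp _ [H1 H2 H3]; split=> //; lia.
have lenB : len <= B by lia.
set h := len %/ 2.
have h0 : 0 < h by rewrite /h; lia.
have hl : h < len by rewrite /h; lia.
have he : h <= 2 ^ e by rewrite /h; move: lene; rewrite expnS; lia.
have he' : len - h <= 2 ^ e by rewrite /h; move: lene; rewrite expnS; lia.
have [o1 [ex1 r1 w1 [E1' Q1 lw1 ld1]]] :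
  wp (Seq (Assign rn (Bin OpDiv (Reg rn) (Lit 2))) (Call k)) (rfn lo len) M Sh (footprint Wr lo h)
   (fun rf' M' wk dp => [/\ True, Post lo h M', wk + (Wc + 30) <= h * (Wl + Wc + 40) + 4
       & dp <= e * (Dc + 30) + Dl + 14]).
  apply: wp_seq; apply: (wp_assign h); rewrite /= ?E2 //.
  rewrite /rfn upd_upd -/(rfn lo h).
  apply: (wp_post (IH lo h h0 he _)); first lia.
  by move=> rf' M' wk dp _ [_ H1 H2 H3]; split=> //; lia.
have [o2 [ex2 r2 w2 [E2' Q2 lw2 ld2]]] :
  wp (Seq (Assign rl (Bin OpAdd (Reg rl) (Bin OpDiv (Reg rn) (Lit 2))))
           (Seq (Assign rn (Bin OpSub (Reg rn) (Bin OpDiv (Reg rn) (Lit 2))))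
                (Call k))) (rfn lo len) M Sh (footprint Wr (lo + h) (len - h))
   (fun rf' M' wk dp => [/\ True, Post (lo + h) (len - h) M',
       wk + (Wc + 30) <= (len - h) * (Wl + Wc + 40) + 12
       & dp <= e * (Dc + 30) + Dl + 22]).
  apply: wp_seq; apply: (wp_assign (lo + h)); rewrite /= ?E1 ?E2 -/h //.
    by split=> //; lia.
  have E3 : upd (rfn lo len) rl (lo + h) rn = len by rewrite upd_neq ?E2 //; exact: nesym.
  apply: wp_seq; apply: (wp_assign (len - h)); rewrite /= ?E3 //.
  have -> : upd (upd (rfn lo len) rl (lo + h)) rn (len - h) = rfn (lo + h) (len - h).
    rewrite /rfn (updC _ _ _ (r:=rn)); last exact: nesym.
    by rewrite upd_upd upd_upd.
  apply: (wp_post (IH (lo + h) (len - h) _ he' _)); [lia|lia|].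
  by move=> rf' M' wk dp _ [_ H1 H2 H3]; split=> //; lia.
have disj a : footprint Wr lo h a -> ~ footprint Wr (lo + h) (len - h) a.
  move=> [i Hi Wi] [j Hj Wj]; have := Wr_inj _ _ Wi Wj; lia.
have nSh lo' len' a : lo' + len' <= tot -> footprint Wr lo' len' a -> ~ Sh a.
  by move=> lT [i Hi]; apply: Wr_Sh; lia.
have rfree : race_free o1 o2.
  rewrite /race_free -!all_predC; apply/andP; split; apply/allP => a /=.
    rewrite mem_cat => Ha; apply/negP => /w1 Wa; case/orP: Ha => [/r2[]|/w2].
    - by apply: nSh Wa; lia.
    - exact: disj.
    - exact: disj.
  move=> /r1 Ha; apply/negP => /w2 Wa; case: Ha => [|H].
    by apply: nSh Wa; lia.
  exact: disj H Wa.
apply: wp_seq; eexists; split; first exact: (exec_Par ex1 ex2 rfree).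
- move=> a /=; rewrite mem_cat => /orP[/r1|/r2] [|H]; try by left.
    by right; apply: footprint_sub H; lia.
  by right; apply: footprint_sub H; lia.
- move=> a /=; rewrite mem_cat => /orP[/w1|/w2] H.
    by apply: footprint_sub H; lia.
  by apply: footprint_sub H; lia.
set Mm := omem _; set rfm := oregs _.
have Em1 a : footprint Wr lo h a -> omem o1 a = Mm a.
  move=> Wa; rewrite /Mm /=; case: ifPn => // /(exec_frame ex1)->.
  by rewrite (exec_frame ex2) //; apply/negP => /w2; exact: disj.
have Em2 a : footprint Wr (lo + h) (len - h) a -> omem o2 a = Mm a.
  move=> Wa; rewrite /Mm /=; case: ifPn => // /w1 H; by case: (disj a).
have Em a : ~ footprint Wr lo (h + (len - h)) a -> Mm a = M a.
  move=> nW; have n1 : a \notin owrites o1.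
    by apply/negP => /w1 H; apply: nW; apply: footprint_sub H; lia.
  have n2 : a \notin owrites o2.
    by apply/negP => /w2 H; apply: nW; apply: footprint_sub H; lia.
  by rewrite /Mm /= (negbTE n1) (exec_frame ex2).
have hl' : h + (len - h) = len by lia.
have := combP (lo := lo) (l1 := h) (l2 := len - h) (M1 := Mm) h0.
rewrite hl' => /(_ _ _ (erefl _)) H.
apply: wp_scoped; last first.
  by move=> M' wk wk' dp dp' l1 l3 [? ? ? ?]; split=> //; lia.
apply: (wp_post (H _ _ _ _ _)).
- lia.
- lia.
- by rewrite hl' in Em.
- by apply: Post_local Em1 Q1; lia.
- by apply: Post_local Em2 Q2; lia.
move=> rf' M' wk dp _ [P1 P2 P3]; split=> //=.
  have : h * (Wl + Wc + 40) + (len - h) * (Wl + Wc + 40) = len * (Wl + Wc + 40).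
    by rewrite -mulnDl hl'.
  lia.
rewrite mulSn /maxn; case: ifP; lia.
Qed.

Lemma wp_tree e bound : 0 < tot -> tot <= 2 ^ e ->
  eval_below B rf bound -> eval_nat rf bound = tot ->
  wp (tree_call k rl rn bound) rf M Sh (footprint Wr 0 tot)
    (fun rf' M' wk dp => [/\ rf' = rf, Post 0 tot M',
       wk <= tot * (Wl + Wc + 40) + expr_size bound &
       dp <= e * (Dc + 30) + Dl + 20 + expr_size bound]).
Proof.
move=> t0 te Hb Eb; apply: wp_scoped; last first.
  by move=> M' wk wk' dp dp' ? ? [? ? ? ?]; split=> //; lia.
apply/wp_seq/(wp_assign tot) => //; apply/wp_seq/(wp_assign 0) => //=.
rewrite updC; last exact: nesym.
apply: (wp_post (wp_tree_rec (lo := 0) t0 te (leqnn tot))).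
by move=> rf' M' wk dp _ [_ H1 H2 H3]; split=> //; lia.
Qed.

End Tree.

Lemma wp_pfor k rl rn leaf rf M tot e bound (Sh : nat -> Prop) (Wr : nat -> nat -> Prop)
    (Q : nat -> (nat -> nat) -> Prop) Wl Dl :
  onth P k = Some (tree_proc k rl rn leaf Skip) -> rl <> rn ->
  tot <= B ->
  (forall i i' a, i < tot -> i' < tot -> Wr i a -> Wr i' a -> i = i') ->
  (forall i a, i < tot -> Wr i a -> ~ Sh a) ->
  (forall i M1 M2, i < tot -> (forall a, Wr i a -> M1 a = M2 a) -> Q i M1 -> Q i M2) ->
  (forall i, i < tot -> wp leaf (upd (upd rf rl i) rn 1) M Sh (Wr i)
     (fun _ M' wk dp => [/\ Q i M', wk <= Wl & dp <= Dl])) ->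
  0 < tot -> tot <= 2 ^ e ->
  eval_below B rf bound -> eval_nat rf bound = tot ->
  wp (tree_call k rl rn bound) rf M Sh (footprint Wr 0 tot)
    (fun rf' M' wk dp => [/\ rf' = rf, forall i, i < tot -> Q i M',
       wk <= tot * (Wl + 41) + expr_size bound &
       dp <= e * 31 + Dl + 20 + expr_size bound]).
Proof.
move=> Pk rlrn totB inj dis loc lf t0 te Hb Eb.
pose Post lo len M := forall i, lo <= i < lo + len -> Q i M.
have H := @wp_tree k rl rn leaf Skip rf M tot Sh Wr Post Wl Dl 1 1 Pk rlrn totB inj dis.
apply: (wp_post (H _ _ _ e bound t0 te Hb Eb)).
- move=> lo len M1 M2 len0 lT E H1 i Hi; apply: (loc i M1); [lia| |exact: H1].
  by move=> a Wa; apply: E; exists i.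
- move=> i iT; apply: (wp_post (lf i iT)) => rf' M' wk dp _ [q1 q2 q3]; split=> //.
  by move=> j Hj; have -> : j = i by lia.
- move=> lo l1 l2 M1 _ _ _ _ _ H1 H2; apply: wp_skip; split=> //.
  move=> i Hi; case: (ltnP i (lo + l1)) => Hl; [apply: H1|apply: H2]; lia.
move=> rf' M' wk dp _ [h1 h2 h3 h4]; split=> //.
by rewrite -(addnA Wl) in h3.
Qed.

End Wp.

Arguments wp_assign {R n m v w P B} B2 Bw {r e rf M Sh Wr} x {Q}.
Arguments wp_fetch {R n m v w P B} B2 Bw {r e rf M Sh Wr} a x {Q}.
Arguments wp_store {R n m v w P B} B2 Bw {e1 e2 rf M Sh Wr} a x {Q}.
Arguments wp_compare {R n m v w P B} B2 Bw {r e1 e2 e3 rf M Sh Wr} i g h {Q}.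
Arguments wp_while_end {R n m v w P B} B2 Bw {e c rf M Sh Wr Q}.

(** * Rounds as a map on codes *)

Lemma digits_ltn b (f : nat -> nat) n : (forall i, i < n -> f i < b) ->
  \sum_(0 <= i < n) f i * b ^ i < b ^ n.
Proof.
elim: n => [|n IH] H; first by rewrite big_nil expn0.
have b0 : 0 < b by apply: leq_ltn_trans (H 0 _).
rewrite big_nat_recr //= expnS.
have := IH (fun i lt => H i (ltnW lt)); have := H n (ltnSn n).
move: (b ^ n) (f n) (\sum_(_ <= _ < _) _) => B x y; nia.
Qed.

Lemma digits_sum b (f : nat -> nat) n j : (forall i, i < n -> f i < b) -> j < n ->
  (\sum_(0 <= i < n) f i * b ^ i) %/ b ^ j %% b = f j.
Proof.
elim: n => [|n IH] H // jn.
have b0 : 0 < b by apply: leq_ltn_trans (H 0 _).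
have H' i : i < n -> f i < b by move=> lt; apply/H/ltnW.
rewrite big_nat_recr //=; case: (ltngtP j n) => [lt|gt|->].
- have -> : b ^ n = b ^ (n - j.+1) * b * b ^ j by rewrite -expnSr -expnD; congr expn; lia.
  by rewrite !mulnA addnC divnMDl ?expn_gt0 ?b0 // modnMDl IH.
- by move: jn; lia.
- by rewrite addnC divnMDl ?expn_gt0 ?b0 // divn_small ?digits_ltn // addn0 modn_small // H.
Qed.

Section Model.

Context (m N : nat) (rk : nat -> nat -> nat).

(* A state is coded by a number with [N] digits in base [m + 1]; digit [j] counts
   how many first goods in the list of the agent in position [j] are known to be
   taken, so that the goods taken are those in one of these prefixes. *)
Definition digit (s j : nat) : nat := s %/ m.+1 ^ j %% m.+1.

Definition avail (s g : nat) : bool := all (fun j => digit s j <= rk j g) (iota 0 N).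

(** When no good is available [find] returns the length [m] of the list, so the value [m] means that
    nothing is left. *)
Definition minrank (j : nat) (av : nat -> bool) : nat :=
  find (fun r => has (fun g => av g && (rk j g == r)) (iota 0 m)) (iota 0 m).

(** From the rank of the chosen good to the length of the prefix that ends with it; the exhausted
    case [m] stays [m], within the range of a digit. *)
Definition bump (x : nat) : nat := x + (x < m).

Fixpoint round_avail (av : nat -> bool) (j : nat) : nat -> bool :=
  if j is j'.+1 then
    fun g => round_avail av j' g && (bump (minrank j' (round_avail av j')) <= rk j' g)
  else av.

Definition round_digit av j := bump (minrank j (round_avail av j)).

Definition round_code av j := \sum_(0 <= i < j) round_digit av i * m.+1 ^ i.

Definition next_code s := round_code (avail s) N.

Lemma minrank_le_m j av : minrank j av <= m.
Proof. by have := find_size (fun r => has (fun g => av g && (rk j g == r)) (iota 0 m)) (iota 0 m); rewrite size_iota. Qed.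

Lemma minrank_le j (av : nat -> bool) g : g < m -> av g -> rk j g < m -> minrank j av <= rk j g.
Proof.
move=> gm ag rm; rewrite leqNgt; apply/negP => /(before_find 0).
rewrite nth_iota // add0n => /hasP[]; exists g; first by rewrite mem_iota.
by rewrite ag eqxx.
Qed.

Lemma minrank_ex j (av : nat -> bool) : minrank j av < m ->
  exists g, [/\ g < m, av g & rk j g = minrank j av].
Proof.
move=> lt; have : has (fun r => has (fun g => av g && (rk j g == r)) (iota 0 m)) (iota 0 m).
  by rewrite has_find size_iota.
move/(nth_find 0); rewrite nth_iota // => /hasP[g].
by rewrite mem_iota => gm /andP[ag /eqP e]; exists g.
Qed.

(** Giving taken goods the value [m], the default of [find], turns the selection into a plain
    minimum over all goods, as a fork tree computes it. *)
Lemma minrankE j (av : nat -> bool) x : (forall g, g < m -> rk j g < m) ->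
  (forall g, g < m -> x <= if av g then rk j g else m) ->
  (exists2 g, g < m & x = if av g then rk j g else m) -> x = minrank j av.
Proof.
move=> rm lb [g gm Eg]; apply/eqP; rewrite eqn_leq; apply/andP; split.
  case: (ltnP (minrank j av) m) => [/minrank_ex[h [hm ah <-]]|le].
    by have := lb h hm; rewrite ah.
  apply: leq_trans (lb g gm) _; apply: leq_trans le.
  by case: ifP => // _; exact/ltnW/rm.
rewrite Eg; case: ifP => ag; last exact: minrank_le_m.
by apply: minrank_le => //; exact: rm.
Qed.

Lemma round_digit_le (av : nat -> bool) j : round_digit av j <= m.
Proof. by rewrite /round_digit /bump; have := minrank_le_m j (round_avail av j); lia. Qed.

Lemma digit_le s j : digit s j <= m.
Proof. by rewrite -ltnS ltn_mod. Qed.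

Lemma round_code_ltn (av : nat -> bool) j : round_code av j < m.+1 ^ j.
Proof. by apply: digits_ltn => i _; rewrite ltnS round_digit_le. Qed.

Lemma next_ltn s : next_code s < m.+1 ^ N.
Proof. exact: round_code_ltn. Qed.

Lemma digit_next s j : j < N -> digit (next_code s) j = round_digit (avail s) j.
Proof. by move=> jN; apply: digits_sum => // i _; rewrite ltnS round_digit_le. Qed.

Lemma round_availE (av : nat -> bool) j g :
  round_avail av j g = av g && all (fun i => round_digit av i <= rk i g) (iota 0 j).
Proof.
elim: j => [|j IH]; first by rewrite /= andbT.
have -> : iota 0 j.+1 = rcons (iota 0 j) j by rewrite -addn1 iotaD cats1.
by rewrite all_rcons andbCA andbC -IH.
Qed.

Lemma round_avail_sub (av : nat -> bool) j g : round_avail av j g -> av g.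
Proof. by rewrite round_availE => /andP[]. Qed.

Lemma round_avail_le (av : nat -> bool) i j g : i <= j -> round_avail av j g -> round_avail av i g.
Proof.
rewrite !round_availE => ij /andP[-> /allP H]; apply/allP => k.
by rewrite mem_iota => Hk; apply: H; rewrite mem_iota; lia.
Qed.

(** A chosen good is available, hence lies beyond the old prefix; if none is left, the new digit is
    the largest possible one. *)
Lemma digit_round s j : j < N -> digit s j <= round_digit (avail s) j.
Proof.
move=> jN; rewrite /round_digit /bump; set x := minrank _ _.
case: (ltnP x m) => xm.
  have [g [gm /round_avail_sub/allP H E]] := minrank_ex xm.
  rewrite /x -E; apply: leq_trans (H j _) _; rewrite ?mem_iota //; lia.
by have := digit_le s j; lia.
Qed.

(** Since no digit decreases, the new prefixes contain the old ones, and the new code alone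
    determines what is still available. *)
Lemma avail_next s g : avail (next_code s) g = round_avail (avail s) N g.
Proof.
rewrite round_availE; apply/allP/andP => [H|[_ /allP H] j].
  split; apply/allP => j Hj.
    by apply: leq_trans (H j Hj); rewrite digit_next ?digit_round //; move: Hj; rewrite mem_iota.
  by have := H j Hj; rewrite digit_next //; move: Hj; rewrite mem_iota.
by move=> Hj; rewrite digit_next ?H //; move: Hj; rewrite mem_iota.
Qed.

Lemma avail0 g : avail 0 g.
Proof. by apply/allP => j _; rewrite /digit div0n mod0n. Qed.

Lemma avail_iter_le t t' g : t <= t' -> avail (iter t' next_code 0) g -> avail (iter t next_code 0) g.
Proof.
move/subnK<-; elim: (t' - t) => [|d IH] //=.
by rewrite avail_next => /round_avail_sub.
Qed.

End Model.

(** * The codes follow the rounds of the actual procedure *)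

Section Link.

Context (R : realFieldType) (n m : nat) (v : 'I_n -> 'I_m -> R).
Context (pi : 'I_n -> seq 'I_m) (sigma : {perm 'I_n}).
Hypothesis pi_pref : forall i, pref_list (v i) (pi i).
Hypothesis n0 : 0 < n.

Let N := minn n m.
Context (rk : nat -> nat -> nat).
Hypothesis rkE : forall (k : 'I_n) (g : 'I_m), rk k g = index g (pi (sigma k)).

Local Notation avail := (avail m N rk).
Local Notation next_code := (next_code m N rk).
Local Notation round_avail := (round_avail m rk).

Definition remains (st : rr_state n m) (av : nat -> bool) : Prop :=
  forall g : 'I_m, (g \in st.1) = av g.

Lemma rk_ltn (k : 'I_n) (g : 'I_m) : rk k g < m.
Proof.
have [pE _] := pi_pref (sigma k).
by rewrite rkE -[m in _ < m]size_enum_ord -(perm_size pE) index_mem (mem_pi pi_pref).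
Qed.

Lemma rk_inj (k : 'I_n) (g h : 'I_m) : rk k g = rk k h -> g = h.
Proof. by rewrite !rkE => /(congr1 (nth g (pi (sigma k)))); rewrite !nth_index ?(mem_pi pi_pref). Qed.

(** Ranks are distinct, so among the available goods exactly the picked one has rank below [bump] of
    the minimum: extending the prefix removes that good and no other. *)
Lemma turn_model st (av : nat -> bool) (k : 'I_n) : remains st (round_avail av k) ->
  let st' := rr_turn pi st (sigma k) in
  remains st' (round_avail av k.+1) /\
  forall i (g : 'I_m), (g \in st'.2 i) = (g \in st.2 i) ||
    [&& round_avail av k g, ~~ round_avail av k.+1 g & i == sigma k].
Proof.
move=> C /=; set ra := round_avail av k in C *.
case: (rr_turnP pi_pref) => [E|g0 g0in Hmin].
  have Z (g : 'I_m) : ra g = false by rewrite -C E inE.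
  by split=> [g|i g]; rewrite !Z ?orbF //= E inE.
have ag0 : ra g0 by rewrite -C.
have le1 := minrank_le (ltn_ord g0) ag0 (rk_ltn k g0).
have Emin : minrank m rk k ra = rk k g0.
  apply/eqP; rewrite eqn_leq le1 /=.
  have [h [hm ah <-]] := minrank_ex (leq_ltn_trans le1 (rk_ltn k g0)).
  have := Hmin (Ordinal hm); rewrite C -!rkE; exact.
have Er (h : 'I_m) : ra h && (bump m (minrank m rk k ra) <= rk k h) = (h != g0) && ra h.
  rewrite Emin /bump rk_ltn addn1 andbC; case ah: (ra h); rewrite ?andbF // !andbT.
  have := Hmin h; rewrite C ah -!rkE => /(_ isT) le.
  rewrite ltn_neqAle le andbT; congr (~~ _); apply/eqP/eqP => [/rk_inj|->] //.
split=> [h|i h]; first by rewrite /= !inE Er C.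
rewrite Er /= ffunE; case: (eqVneq i (sigma k)) => [->|_]; last by rewrite !andbF orbF.
rewrite !inE andbT; case: (eqVneq h g0) => [->|_] /=; first by rewrite ag0 orbT.
by rewrite andbN orbF.
Qed.

Let order := [seq sigma k | k <- enum 'I_n].

Lemma take_order (k : 'I_n) : take k.+1 order = rcons (take k order) (sigma k).
Proof.
have so : size order = n by rewrite size_map size_enum_ord.
rewrite (take_nth (sigma k)) ?so // /order.
by rewrite (nth_map k) ?size_enum_ord // nth_ord_enum.
Qed.

Lemma turns_model st (av : nat -> bool) k : k <= n -> remains st av ->
  let st' := foldl (rr_turn pi) st (take k order) in
  [/\ remains st' (round_avail av k),
      forall i (g : 'I_m), round_avail av k g || ~~ av g -> (g \in st'.2 i) = (g \in st.2 i) &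
      forall (j : 'I_n) (g : 'I_m), j < k -> round_avail av j g -> ~~ round_avail av j.+1 g ->
        forall i, (g \in st'.2 i) = (g \in st.2 i) || (i == sigma j)].
Proof.
move=> + C; elim: k => [|k IH] kn; first by rewrite take0.
have [C1 C2 C3] := IH (ltnW kn).
have -> : take k.+1 order = rcons (take k order) (sigma (Ordinal kn)).
  exact: (take_order (Ordinal kn)).
rewrite foldl_rcons; set st1 := foldl _ _ _ in C1 C2 C3 *.
have [D1 D2] := turn_model (k := Ordinal kn) C1.
split=> //.
- move=> i g /orP H; rewrite D2.
  have [kg|nkg] := boolP (round_avail av k.+1 g).
    by rewrite andbF orbF C2 // (round_avail_le (leqnSn k) kg).
  case: H => [H|nav]; first by rewrite H in nkg.
  rewrite C2 ?nav ?orbT //.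
  have -> : round_avail av (Ordinal kn) g = false.
    by apply: contraNF nav => /round_avail_sub.
  by rewrite orbF.
- move=> j g jk aj naj i; rewrite D2.
  move: jk; rewrite ltnS leq_eqVlt => /orP[/eqP E|jk].
    have E' : j = Ordinal kn by apply: val_inj.
    by rewrite -E' aj naj C2 // -E aj.
  rewrite (C3 j g jk aj naj); have -> : round_avail av (Ordinal kn) g = false.
    by apply: contraNF naj => /(round_avail_le jk).
  by rewrite orbF.
Qed.

Lemma card_turns l st : #|(foldl (rr_turn pi) st l).1| = #|st.1| - size l.
Proof.
elim: l st => [|i l IH] st /=; first by rewrite subn0.
rewrite IH; case: (rr_turnP pi_pref) => [->|g gin _]; first by rewrite cards0.
by rewrite /= (cardsD1 g st.1) gin add1n subSS.
Qed.

Lemma turns_empty l st : st.1 = set0 -> foldl (rr_turn pi) st l = st.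
Proof.
move=> E; elim: l => [|i l IH] //=.
by case: (rr_turnP pi_pref) => // g; rewrite E inE.
Qed.

(* With more agents than goods, the agents after position [m] find nothing. *)
Lemma round_take st : rr_round pi sigma st = foldl (rr_turn pi) st (take N order).
Proof.
rewrite /rr_round -/order -{1}(cat_take_drop N order) foldl_cat.
have so : size order = n by rewrite size_map size_enum_ord.
case: (leqP n m) => nm; first by rewrite drop_oversize // so /N; lia.
rewrite turns_empty //; apply/eqP; rewrite -cards_eq0 card_turns.
rewrite size_take so /N; have := max_card st.1; rewrite card_ord; case: ifP; lia.
Qed.

Let st t := iter t (rr_round pi sigma) ([set: 'I_m], [ffun=> set0]).
Let code t := iter t next_code 0.

Let N_le_n : N <= n. Proof. by rewrite /N geq_minl. Qed.

Lemma rounds_remain t : remains (st t) (avail (code t)).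
Proof.
elim: t => [|t IH] g; first by rewrite /= inE avail0.
have [H _ _] := turns_model N_le_n IH.
by rewrite [st _]/= round_take H [code _]/= avail_next.
Qed.

Lemma rounds_fresh t i (g : 'I_m) : avail (code t) g -> g \notin (st t).2 i.
Proof.
elim: t => [|t IH]; first by rewrite /= ffunE inE.
rewrite [code _]/= => av1; have av0 := av1; rewrite avail_next in av0.
have [_ H _] := turns_model N_le_n (rounds_remain t).
rewrite [st _]/= round_take H ?av0 //; apply: IH; exact: round_avail_sub av0.
Qed.

Lemma rounds_exhaust t (g : 'I_m) : m <= t -> avail (code t) g = false.
Proof.
move=> mt; rewrite -rounds_remain.
suff H : #|(st t).1| <= m - t.
  have /eqP : #|(st t).1| == 0 by lia.
  by move/eqP; rewrite cards_eq0 => /eqP->; rewrite inE.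
elim: (t) => [|u IH]; first by have := max_card (st 0).1; rewrite card_ord subn0.
by rewrite [st _]/= /rr_round card_turns size_map size_enum_ord; lia.
Qed.

(** Later agents may also have [g] in their new prefix. The first position with this property is the
    taker: the prefixes of earlier positions miss [g], so it is still available when [j] moves and
    no longer afterwards. *)
Lemma owner_round_robin t (j : 'I_n) (g : 'I_m) :
  avail (code t) g -> ~~ avail (code t.+1) g -> j < N ->
  rk j g < digit m (code t.+1) j ->
  (forall i, i < j -> digit m (code t.+1) i <= rk i g) ->
  forall i, (g \in round_robin pi sigma i) = (i == sigma j).
Proof.
move=> at0 nat1 jN Hj Hlt i.
have tm : t.+1 <= m by rewrite ltnNge; apply: contraL at0 => /rounds_exhaust->.
rewrite /round_robin -/(st m).
(* Here [d] counts the rounds after the good is gone; they leave its owner unchanged. *)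
suff H d : (g \in (st (d + t.+1)).2 i) = (i == sigma j) by rewrite -(H (m - t.+1)) subnK.
elim: d => [|d IH].
  have [_ _ H] := turns_model N_le_n (rounds_remain t).
  rewrite add0n [st _]/= round_take (H j g jN) ?(negbTE (rounds_fresh i at0)) //.
    rewrite round_availE at0; apply/allP => k; rewrite mem_iota => Hk.
    by rewrite -digit_next ?Hlt //; lia.
  by rewrite /= negb_and -ltnNge -[bump _ _]/(round_digit m rk _ _) -digit_next // Hj orbT.
have na : ~~ avail (code (d + t.+1)) g.
  by apply: contra nat1; apply: avail_iter_le; lia.
have [_ H _] := turns_model N_le_n (rounds_remain (d + t.+1)).
by rewrite addSn [st _]/= round_take H ?na ?orbT.
Qed.

End Link.

(** * The program *)

Declare Scope prog_scope.
Delimit Scope prog_scope with prog.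
Local Notation "'$' k" := (Reg k) (at level 0, k at level 0, format "'$' k") : prog_scope.
Local Notation "'#' k" := (Lit k) (at level 0, k at level 0, format "'#' k") : prog_scope.
Local Notation "a :+: b" := (Bin OpAdd a b) (at level 50, left associativity) : prog_scope.
Local Notation "a :-: b" := (Bin OpSub a b) (at level 50, left associativity) : prog_scope.
Local Notation "a :*: b" := (Bin OpMul a b) (at level 40, left associativity) : prog_scope.
Local Notation "a :/: b" := (Bin OpDiv a b) (at level 40, left associativity) : prog_scope.
Local Notation "a :%: b" := (Bin OpMod a b) (at level 40, left associativity) : prog_scope.
Local Notation "a :<: b" := (Bin OpLt a b) (at level 70) : prog_scope.
Local Notation "c1 ;; c2" := (Seq c1 c2) (at level 90, right associativity) : prog_scope.
Local Notation "r ::= e" := (Assign r e) (at level 85) : prog_scope.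
Local Open Scope prog_scope.

(* Registers 0 to 6 hold [n], [m], [N = min n m], [m + 1], [S = (m + 1) ^ N],
   [Z] and [K], where [Z] exceeds the size of every array below and [K] is the
   number of tables.  The memory is cut into pages of [Z] cells: the input,
   followed by the powers of [m + 1]; the ranks; a workspace to count them; the
   goods available in the round that starts in each state; a workspace to select
   the best of them; the tables of the [2 ^ k]-th iterates of the round; and two
   workspaces, with one cell for each good. *)
Local Notation pw_at j := ($1 :+: $0 :+: $0 :*: $1 :+: j).
Local Notation rank_at j g := ($5 :+: j :*: $1 :+: g).
Local Notation count_at x h := (#2 :*: $5 :+: x :*: $1 :+: h).
Local Notation avail_at s g := (#3 :*: $5 :+: s :*: $1 :+: g).
Local Notation best_at s g := (#4 :*: $5 :+: s :*: $1 :+: g).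
Local Notation table_at k s := (#5 :*: $5 :+: k :*: $4 :+: s).
Local Notation pos_at g := (#6 :*: $5 :+: g).
Local Notation flag_at g := (#7 :*: $5 :+: g).

(** Boolean connectives are arithmetic: products are conjunctions and [1 - b] is negation. The
    stored bit says whether good [$12] precedes good [$15] in the list of agent [$14], strictly by
    value or by the tie-breaking rank. *)
Definition count_leaf : cmd :=
  Compare 16 $14 $15 $12 ;;
  Compare 17 $14 $12 $15 ;;
  Fetch 18 ($1 :+: $0 :+: $14 :*: $1 :+: $12) ;;
  Fetch 19 ($1 :+: $0 :+: $14 :*: $1 :+: $15) ;;
  Store (count_at $10 $12) ($16 :*: (#1 :-: $17 :*: (#1 :-: ($18 :<: $19)))).

Definition count_comb : cmd :=
  Fetch 16 (count_at $10 $12) ;;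
  Fetch 17 (count_at $10 ($12 :+: $13 :/: #2)) ;;
  Store (count_at $10 $12) ($16 :+: $17).

Definition rank_leaf : cmd :=
  16 ::= $10 :/: $1 ;;
  15 ::= $10 :%: $1 ;;
  Fetch 14 ($1 :+: $16) ;;
  tree_call 2 12 13 $1 ;;
  Fetch 16 (count_at $10 #0) ;;
  Store ($5 :+: $10) $16.

Definition init_leaf : cmd := Store (avail_at $10 $12) #1.

Definition best_leaf : cmd :=
  Fetch 16 (avail_at $10 $12) ;;
  Fetch 17 (rank_at $14 $12) ;;
  Store (best_at $10 $12) ($16 :*: $17 :+: (#1 :-: $16) :*: $1).

(** With truncated subtraction [a - (a - b)] is the minimum of [a] and [b]. *)
Definition best_comb : cmd :=
  Fetch 16 (best_at $10 $12) ;;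
  Fetch 17 (best_at $10 ($12 :+: $13 :/: #2)) ;;
  Store (best_at $10 $12) ($16 :-: ($16 :-: $17)).

Definition filter_leaf : cmd :=
  Fetch 16 (rank_at $14 $12) ;;
  Fetch 17 (avail_at $10 $12) ;;
  Store (avail_at $10 $12) ($17 :*: (#1 :-: ($16 :<: $15))).

(** The first loop decodes the state into a row of availability bits, so that a move costs [O(m)]
    work instead of [O(N * m)]. The second plays the round and accumulates the new code digit by
    digit, in memory because registers do not survive an iteration. *)
Definition round_leaf : cmd :=
  tree_call 4 12 13 $1 ;;
  for_loop 14 $2
    (Fetch 16 (pw_at $14) ;;
     15 ::= $10 :/: $16 :%: $3 ;;
     tree_call 6 12 13 $1) ;;
  Store (table_at #0 $10) #0 ;;
  for_loop 14 $2
    (tree_call 5 12 13 $1 ;;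
     Fetch 16 (best_at $10 #0) ;;
     15 ::= $16 :+: ($16 :<: $1) ;;
     Fetch 16 (pw_at $14) ;;
     Fetch 17 (table_at #0 $10) ;;
     Store (table_at #0 $10) ($17 :+: $15 :*: $16) ;;
     tree_call 6 12 13 $1).

Definition double_leaf : cmd :=
  Fetch 16 (table_at $14 $10) ;;
  Fetch 16 (table_at $14 $16) ;;
  Store (table_at ($14 :+: #1) $10) $16.

(* Binary lifting to the last state in which the good is not taken; the first
   agent whose prefix contains the good in the next state is its owner, and the
   loop that looks for it goes downwards so that this agent writes last. *)
Definition owner_leaf : cmd :=
  Store (pos_at $10) #0 ;;
  for_loop 12 $6
    (Fetch 16 (pos_at $10) ;;
     Fetch 17 (table_at ($6 :-: #1 :-: $12) $16) ;;
     Store (flag_at $10) #1 ;;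
     for_loop 14 $2
       (Fetch 18 (pw_at $14) ;;
        18 ::= $17 :/: $18 :%: $3 ;;
        Fetch 19 (rank_at $14 $10) ;;
        Fetch 20 (flag_at $10) ;;
        Store (flag_at $10) ($20 :*: (#1 :-: ($19 :<: $18)))) ;;
     Fetch 18 (flag_at $10) ;;
     Store (pos_at $10) ($18 :*: $17 :+: (#1 :-: $18) :*: $16)) ;;
  Fetch 16 (pos_at $10) ;;
  Fetch 17 (table_at #0 $16) ;;
  for_loop 12 $2
    (14 ::= $2 :-: #1 :-: $12 ;;
     Fetch 18 (pw_at $14) ;;
     18 ::= $17 :/: $18 :%: $3 ;;
     Fetch 19 (rank_at $14 $10) ;;
     If ($19 :<: $18) (Fetch 20 ($1 :+: $14) ;; Store $10 $20) Skip).

(** In the page size [$5], the term [S * (m + 1)] makes room for one row per state and, as [K <= m],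
    for the [K] tables; the cubic term makes room for the input with the powers and for the
    [N * m * m] counting cells. *)
Definition main_proc : cmd :=
  If $1
    (2 ::= $0 :-: ($0 :-: $1) ;;
     3 ::= $1 :+: #1 ;;
     Store (pw_at #0) #1 ;;
     for_loop 10 $2
       (Fetch 16 (pw_at $10) ;;
        Store (pw_at ($10 :+: #1)) ($16 :*: $3)) ;;
     Fetch 4 (pw_at $2) ;;
     5 ::= $4 :*: $3 :+: ($0 :+: #2) :*: ($1 :+: #2) :*: ($1 :+: #2) ;;
     6 ::= #0 ;;
     7 ::= #1 ;;
     While ($7 :<: $1 :+: #1) (7 ::= $7 :*: #2 ;; 6 ::= $6 :+: #1) ;;
     tree_call 1 10 11 ($2 :*: $1) ;;
     tree_call 3 10 11 $4 ;;
     for_loop 14 ($6 :-: #1) (tree_call 7 10 11 $4) ;;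
     tree_call 8 10 11 $1)
    Skip.

Definition rr_program : program :=
  [:: main_proc;
      tree_proc 1 10 11 rank_leaf Skip;
      tree_proc 2 12 13 count_leaf count_comb;
      tree_proc 3 10 11 round_leaf Skip;
      tree_proc 4 12 13 init_leaf Skip;
      tree_proc 5 12 13 best_leaf best_comb;
      tree_proc 6 12 13 filter_leaf Skip;
      tree_proc 7 10 11 double_leaf Skip;
      tree_proc 8 10 11 owner_leaf Skip].

Ltac regs :=
  rewrite /upd /=;
  repeat match goal with
  | H : ?f ?k = ?x :> nat |- context [?f ?k] => is_var f; rewrite H
  end.

Ltac side := regs; repeat split; lia.

Lemma ltn_mul_row m x y : x < y -> x * m + m <= y * m.
Proof. by move=> lt; rewrite -mulSnr leq_mul2r lt orbT. Qed.

(** Lets costs of the preprocessing, such as [N * m * m], be absorbed by those of the [S] states. *)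
Lemma bernoulli m N : N * m < m.+1 ^ N.
Proof.
elim: N => [|N IH]; first by rewrite expn0.
rewrite expnS; have : 0 < m.+1 ^ N by rewrite expn_gt0.
by move: IH; set x := m.+1 ^ N => IH x0; rewrite !mulSn; nia.
Qed.

(** * Specification of each phase of the program *)

Section Program.

Context (R : realFieldType) (n m : nat) (v : 'I_n -> 'I_m -> R).
Context (pi : 'I_n -> seq 'I_m) (tb : 'I_n -> 'I_m -> 'I_m) (sigma : {perm 'I_n}).
Hypothesis pi_pref : forall i, pref_list (v i) (pi i).
Hypothesis pi_ties : forall i, breaks_ties (v i) (tb i) (pi i).
Context (N S Z K w : nat).
Hypotheses (m0 : 0 < m) (N0 : 0 < N) (Nn : N <= n) (Nm : N <= m).
Hypothesis SE : S = m.+1 ^ N.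
Hypotheses (mK : m < 2 ^ K) (K0 : 0 < K).
Hypotheses (Z_input : m + n + n * m + N < Z) (Z_count : N * m * m <= Z)
  (Z_avail : S * m.+1 <= Z) (Z_table : K * S <= Z).
Hypothesis Bw : 8 * Z < 2 ^ w.

Let S0 : 0 < S. Proof. by rewrite SE expn_gt0. Qed.
Let B2 : 2 <= 8 * Z. Proof. lia. Qed.
Let Z_S : S <= Z. Proof. by apply: leq_trans Z_avail; rewrite leq_pmulr. Qed.

Local Notation wp := (wp v w rr_program).

Definition position_rank (j g : nat) : nat :=
  if insub j is Some k then index g [seq val x | x <- pi (sigma k)] else 0.

Local Notation rk := position_rank.

Lemma position_rankE (k : 'I_n) (g : 'I_m) : rk k g = index g (pi (sigma k)).
Proof. by rewrite /rk valK index_map //; exact: val_inj. Qed.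

Definition globals (rf : nat -> nat) : Prop :=
  [/\ rf 0 = n, rf 1 = m & rf 2 = N] /\ [/\ rf 3 = m.+1, rf 4 = S, rf 5 = Z & rf 6 = K].

Definition input_mem (M : nat -> nat) : Prop :=
  (forall k : 'I_n, M (m + k) = sigma k) /\
  (forall (i : 'I_n) (g : 'I_m), M (m + n + i * m + g) = tb i g).

(** The right-hand side uses only what the machine can observe: two comparisons of values and the
    tie-breaking ranks. *)
Lemma index_before i (g h : 'I_m) :
  (index h (pi i) < index g (pi i)) =
  (v i g <= v i h)%R && (~~ (v i h <= v i g)%R || (tb i h < tb i g)).
Proof.
have lt x y : (v i x < v i y)%R -> index y (pi i) < index x (pi i).
  by rewrite ltNge ltnNge; apply: contraNN => /(index_pref_le pi_pref).
case: (ltgtP (v i g) (v i h)) => [/lt//|/lt H|E].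
  by rewrite ltnNge (ltnW H).
by rewrite (pi_ties (esym E)).
Qed.

Lemma sum_index_before i (g : 'I_m) :
  \sum_(h : 'I_m) (index h (pi i) < index g (pi i)) = index g (pi i).
Proof.
have [pE _] := pi_pref i.
have up : uniq (pi i) by rewrite (perm_uniq pE) enum_uniq.
have sp : size (pi i) = m by rewrite (perm_size pE) size_enum_ord.
rewrite -[LHS]big_enum /= -(perm_big _ pE) /= (big_nth g) sp.
rewrite (eq_big_nat _ _ (F2 := fun t => (t < index g (pi i) : nat))); last first.
  by move=> t /andP[_ tm]; rewrite index_uniq // sp.
have gm : index g (pi i) <= m by have := index_size g (pi i); rewrite sp.
rewrite (big_cat_nat (leq0n _) gm) /= [X in _ + X]big1_seq ?addn0; last first.
  by move=> t /=; rewrite mem_index_iota => /andP[H _]; rewrite ltnNge H.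
rewrite (eq_big_nat _ _ (F2 := fun=> 1)); last by move=> t /andP[_ ->].
by rewrite sum_nat_const_nat subn0 muln1.
Qed.

Lemma wp_count rf M x (j : 'I_n) (g : 'I_m) :
  globals rf -> input_mem M -> x < N * m ->
  rf 10 = x -> rf 14 = sigma j -> rf 15 = g ->
  wp (tree_call 2 12 13 $1) rf M (fun a => a < Z)
     (footprint (fun h a => a = 2 * Z + x * m + h) 0 m)
     (fun rf' M' wk dp => [/\ rf' = rf, M' (2 * Z + x * m) = rk j g,
        wk <= m * 200 & dp <= K * 100 + 100]).
Proof.
move=> [[E0 E1 E2] [E3 E4 E5 E6]] [Is It] xm Ex Ei Eg.
have xb := ltn_mul_row m xm.
pose f h := if insub h is Some h' then (index (h' : 'I_m) (pi (sigma j)) < index g (pi (sigma j)) : nat) else 0.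
pose Post lo len (M : nat -> nat) := M (2 * Z + x * m + lo) = \sum_(lo <= h < lo + len) f h.
have f1 h : f h <= 1 by rewrite /f; case: insub => // ?; exact: leq_b1.
have fs lo len : \sum_(lo <= h < lo + len) f h <= len.
  rewrite -[X in _ <= X](addKn lo) -[X in _ <= X]muln1 -sum_nat_const_nat; exact: leq_sum.
have H := @wp_tree _ _ _ v w rr_program (8 * Z) B2 Bw 2 12 13 count_leaf count_comb
   rf M m (fun a => a < Z) (fun h a => a = 2 * Z + x * m + h) Post 60 60 60 60.
apply: (wp_post (H _ _ _ _ _ _ _ _ K $1 _ _ _ _)); clear H => //.
- lia.
- by move=> i i' a _ _ -> H; lia.
- by move=> i a _ ->; lia.
- by move=> lo len M1 M2 l0 _ E; rewrite /Post -E //; exists lo => //; lia.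
- move=> h hm; rewrite /count_leaf.
  have im : sigma j * m + m <= n * m by rewrite -mulSnr leq_mul2r ltn_ord orbT.
  have gm := ltn_ord g.
  apply/wp_seq/(wp_compare B2 Bw (sigma j) g (Ordinal hm)); try by side.
  apply/wp_seq/(wp_compare B2 Bw (sigma j) (Ordinal hm) g); try by side.
  apply/wp_seq/(wp_fetch B2 Bw (m + n + sigma j * m + h) (tb (sigma j) (Ordinal hm))); try by side.
    by rewrite -It.
  apply/wp_seq/(wp_fetch B2 Bw (m + n + sigma j * m + g) (tb (sigma j) g)); try by side.
    exact: It.
  apply: (wp_store B2 Bw (2 * Z + x * m + h) (f h)); try by side.
    regs; rewrite /f insubT /= index_before.
    by case: (v _ _ <= _)%R; case: (v _ _ <= _)%R; case: (_ < _).
  by split=> //; rewrite /Post mset_eq // addn1 big_nat1.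
- move=> lo l1 l2 M1 l10 l20 lm lE _ P1 P2; rewrite /count_comb.
  have s1 := fs lo l1; have s2 := fs (lo + l1) l2.
  apply/wp_seq/(wp_fetch B2 Bw (2 * Z + x * m + lo) (\sum_(lo <= h < lo + l1) f h)); try by side.
    exact: P1.
    by right; exists lo => //; lia.
  apply/wp_seq/(wp_fetch B2 Bw (2 * Z + x * m + (lo + l1)) (\sum_(lo + l1 <= h < lo + l1 + l2) f h)); try by side.
    exact: P2.
    by right; exists (lo + l1) => //; lia.
  apply: (wp_store B2 Bw (2 * Z + x * m + lo) (\sum_(lo <= h < lo + (l1 + l2)) f h)); try by side.
    by regs; rewrite (addnA lo) (big_cat_nat (leq_addr l1 lo) (leq_addr l2 (lo + l1))).
    by exists lo => //; lia.
  by split=> //; rewrite /Post mset_eq.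
- lia.
move=> rf' M' wk dp _ [-> P1 lw ld]; split=> //; rewrite ?(leq_trans lw) ?(leq_trans ld) //=; try lia.
rewrite -[2 * Z + x * m]addn0 P1 position_rankE -sum_index_before add0n big_mkord.
by apply: eq_bigr => h _; rewrite /f valK.
Qed.

Definition rank_mem (M : nat -> nat) : Prop :=
  forall j g, j < N -> g < m -> M (Z + j * m + g) = rk j g.

Lemma wp_rank rf M :
  globals rf -> input_mem M -> N * m <= 2 ^ (K * N) ->
  wp (tree_call 1 10 11 ($2 :*: $1)) rf M (fun a => a < Z) (fun a => Z <= a < 3 * Z)
     (fun rf' M' wk dp => [/\ rf' = rf, rank_mem M',
        wk <= N * m * (m * 400) & dp <= K * N * 400]).
Proof.
move=> G I e; have [[E0 E1 E2] [E3 E4 E5 E6]] := G; have [Is It] := I.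
pose Wr x a := a = Z + x \/ 2 * Z + x * m <= a < 2 * Z + x * m + m.
pose Q x (M : nat -> nat) := M (Z + x) = rk (x %/ m) (x %% m).
have xb x : x < N * m -> x * m + m <= N * m * m by exact: ltn_mul_row.
have NmZ : N * m <= Z by apply: leq_trans Z_count; rewrite leq_pmulr.
have H := @wp_pfor _ _ _ v w rr_program (8 * Z) B2 Bw 1 10 11 rank_leaf rf M (N * m) (K * N)
  ($2 :*: $1) (fun a => a < Z) Wr Q (m * 200 + 60) (K * 100 + 160).
apply: (wp_conseq (H _ _ _ _ _ _ _ _ _ _ _)); clear H => //; try by side.
- move=> x x' a xN xN'; have := xb x xN; have := xb x' xN'.
  move=> b1 b2 [?|?] [?|?]; try lia.
  by case: (ltngtP x x') => // /(ltn_mul_row m); lia.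
- move=> x a xN; have := xb x xN; rewrite /Wr; lia.
- by move=> x M1 M2 _ E; rewrite /Q E //; left.
- move=> x xN; have b1 := xb x xN; rewrite /rank_leaf.
  have [j [g [jN Ej Eg Ex]]] : exists (j : 'I_n) (g : 'I_m),
      [/\ j < N, x %/ m = j, x %% m = g & x = j * m + g].
    have jN : x %/ m < N by rewrite ltn_divLR.
    exists (Ordinal (leq_trans jN Nn)), (Ordinal (ltn_pmod x m0)).
    by split=> //; exact: divn_eq.
  have EQ : Q x = fun M => M (Z + x) = rk j g by rewrite /Q Ej Eg.
  rewrite EQ; have {}Ej : eval_nat (upd (upd rf 10 x) 11 1) ($10 :/: $1) = j by regs.
  have {}Eg a : eval_nat (upd (upd (upd rf 10 x) 11 1) 16 a) ($10 :%: $1) = g by regs.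
  have xm : x <= 8 * Z by lia.
  have gm := ltn_ord g.
  apply/wp_seq/(wp_assign B2 Bw j) => //; try by side.
  apply/wp_seq/(wp_assign B2 Bw g) => //; try by side.
  clear Ej Eg.
  apply/wp_seq/(wp_fetch B2 Bw (m + j) (sigma j)) => //; try by side.
  apply: wp_seq.
  apply: (wp_conseq (wp_count (x := x) (j := j) (g := g) _ I xN _ _ _)) => //; try by regs.
  + by move=> a [h Hh ->]; right; lia.
  + by move=> a; left.
  move=> rf' M' wk dp _ [-> HM lw ld].
  apply/wp_seq/(wp_fetch B2 Bw (2 * Z + x * m) (rk j g)) => //; try by side.
    by right; right; lia.
  apply: (wp_store B2 Bw (Z + x) (rk j g)) => //; try by side.
    by left.
  split=> /=; first by rewrite mset_eq.
    lia.
  lia.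
- by move=> a [x /andP[_ xN]]; have := xb x xN; rewrite /Wr; lia.
move=> rf' M' wk dp _ [-> HQ lw ld]; split=> //.
- move=> j g jN gm; have := HQ (j * m + g); rewrite /Q addnA divnMDl // divn_small // addn0.
  rewrite modnMDl modn_small //; apply.
  by apply: leq_trans (ltn_mul_row m jN); rewrite ltn_add2l.
- apply: leq_trans lw _; rewrite /=.
  have : N * m * 1 <= N * m * m by rewrite leq_mul2l m0 orbT.
  have : 0 < N * m by rewrite muln_gt0 N0.
  rewrite !mulnDr; lia.
- apply: leq_trans ld _; rewrite /=.
  have : K * 1 <= K * N by rewrite leq_mul2l N0 orbT.
  lia.
Qed.

Lemma rank_ltn j g : j < N -> g < m -> rk j g < m.
Proof.
move=> jN gm.
exact: (rk_ltn pi_pref position_rankE (Ordinal (leq_trans jN Nn)) (Ordinal gm)).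
Qed.

(** * Tabulating one round *)

Local Notation avail := (avail m N rk).
Local Notation next_code := (next_code m N rk).
Local Notation round_avail := (round_avail m rk).
Local Notation round_code := (round_code m rk).
Local Notation minrank := (minrank m rk).

Definition pow_mem (M : nat -> nat) : Prop :=
  forall j, j < N -> M (m + n + n * m + j) = m.+1 ^ j.

Definition avail_mem (s : nat) (av : nat -> bool) (M : nat -> nat) : Prop :=
  forall g, g < m -> M (3 * Z + s * m + g) = av g.

Let row_le s : s < S -> s * m + m <= Z.
Proof. by move=> /(ltn_mul_row m)/leq_trans; apply; apply: leq_trans Z_avail; rewrite leq_mul2l leqnSn orbT. Qed.

Let rank_row_le j : j < N -> j * m + m <= Z.
Proof.
move=> /(ltn_mul_row m)/leq_trans; apply; apply: leq_trans Z_count.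
by rewrite leq_pmulr.
Qed.

Let pow_le j : j < N -> m.+1 ^ j.+1 <= S.
Proof. by move=> jN; rewrite SE leq_exp2l. Qed.

Let mKe : m <= 2 ^ K. Proof. exact: ltnW. Qed.

Lemma wp_init rf M s :
  globals rf -> s < S -> rf 10 = s ->
  wp (tree_call 4 12 13 $1) rf M (fun=> False)
     (fun a => 3 * Z + s * m <= a < 3 * Z + s * m + m)
     (fun rf' M' wk dp => [/\ rf' = rf, avail_mem s xpredT M',
        wk <= m * 200 & dp <= K * 100 + 100]).
Proof.
move=> [[E0 E1 E2] [E3 E4 E5 E6]] sS Es; have sb := row_le sS.
have H := @wp_pfor _ _ _ v w rr_program (8 * Z) B2 Bw 4 12 13 init_leaf rf M m K $1
  (fun=> False) (fun g a => a = 3 * Z + s * m + g) (fun g M => M (3 * Z + s * m + g) = 1) 60 60.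
apply: (wp_conseq (H _ _ _ _ _ _ _ _ _ _ _)); clear H => //; try by side.
- by move=> g M1 M2 _ E; rewrite E.
- move=> g gm; apply: (wp_store B2 Bw (3 * Z + s * m + g) 1) => //; try by side.
  by split=> //; rewrite mset_eq.
- by move=> a [g Hg ->]; lia.
by move=> rf' M' wk dp _ [-> HQ lw ld]; split=> //; rewrite /= in lw ld; lia.
Qed.

Lemma wp_filter rf M s j d (av : nat -> bool) :
  globals rf -> s < S -> rf 10 = s -> j < N -> rf 14 = j -> rf 15 = d ->
  rank_mem M -> avail_mem s av M ->
  wp (tree_call 6 12 13 $1) rf M (fun a => Z <= a < 2 * Z)
     (fun a => 3 * Z + s * m <= a < 3 * Z + s * m + m)
     (fun rf' M' wk dp => [/\ rf' = rf, avail_mem s (fun g => av g && (d <= rk j g)) M',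
        wk <= m * 200 & dp <= K * 100 + 100]).
Proof.
move=> [[E0 E1 E2] [E3 E4 E5 E6]] sS Es jN Ej Ed RM AM.
have sb := row_le sS; have jb := rank_row_le jN.
have H := @wp_pfor _ _ _ v w rr_program (8 * Z) B2 Bw 6 12 13 filter_leaf rf M m K $1
  (fun a => Z <= a < 2 * Z) (fun g a => a = 3 * Z + s * m + g)
  (fun g M => M (3 * Z + s * m + g) = av g && (d <= rk j g)) 60 60.
apply: (wp_conseq (H _ _ _ _ _ _ _ _ _ _ _)); clear H => //; try by side.
- by move=> g M1 M2 _ E; rewrite E.
- move=> g gm; rewrite /filter_leaf.
  apply/wp_seq/(wp_fetch B2 Bw (Z + j * m + g) (rk j g)) => //; try by side.
    exact: RM.
  apply/wp_seq/(wp_fetch B2 Bw (3 * Z + s * m + g) (av g)) => //; try by side.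
    exact: AM.
  apply: (wp_store B2 Bw (3 * Z + s * m + g) (av g && (d <= rk j g))) => //; try by side.
  by split=> //; rewrite mset_eq.
- by move=> a [g Hg ->]; lia.
by move=> rf' M' wk dp _ [-> HQ lw ld]; split=> //; rewrite /= in lw ld; lia.
Qed.

Lemma wp_best rf M s j (av : nat -> bool) :
  globals rf -> s < S -> rf 10 = s -> j < N -> rf 14 = j ->
  rank_mem M -> avail_mem s av M ->
  wp (tree_call 5 12 13 $1) rf M
     (fun a => Z <= a < 2 * Z \/ 3 * Z + s * m <= a < 3 * Z + s * m + m)
     (fun a => 4 * Z + s * m <= a < 4 * Z + s * m + m)
     (fun rf' M' wk dp => [/\ rf' = rf, M' (4 * Z + s * m) = minrank j av,
        wk <= m * 200 & dp <= K * 100 + 100]).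
Proof.
move=> [[E0 E1 E2] [E3 E4 E5 E6]] sS Es jN Ej RM AM.
have sb := row_le sS; have jb := rank_row_le jN.
pose f g := if av g then rk j g else m.
have fm g : g < m -> f g <= m.
  by move=> gm; rewrite /f; case: ifP => // _; exact/ltnW/rank_ltn.
pose Post lo len (M : nat -> nat) :=
  (forall g, lo <= g < lo + len -> M (4 * Z + s * m + lo) <= f g) /\
  exists2 g, lo <= g < lo + len & M (4 * Z + s * m + lo) = f g.
have H := @wp_tree _ _ _ v w rr_program (8 * Z) B2 Bw 5 12 13 best_leaf best_comb
   rf M m (fun a => Z <= a < 2 * Z \/ 3 * Z + s * m <= a < 3 * Z + s * m + m)
   (fun g a => a = 4 * Z + s * m + g) Post 60 60 60 60.
apply: (wp_conseq (H _ _ _ _ _ _ _ _ K $1 _ _ _ _)); clear H => //; try by side.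
- move=> lo len M1 M2 l0 _ E; rewrite /Post E //; exists lo => //; lia.
- move=> g gm; rewrite /best_leaf; have fg := fm g gm; have rg := rank_ltn jN gm.
  apply/wp_seq/(wp_fetch B2 Bw (3 * Z + s * m + g) (av g)) => //; try by side.
    exact: AM.
  apply/wp_seq/(wp_fetch B2 Bw (Z + j * m + g) (rk j g)) => //; try by side.
    exact: RM.
  apply: (wp_store B2 Bw (4 * Z + s * m + g) (f g)) => //.
  + by side.
  + by regs; case: (av g); repeat split; lia.
  + by regs.
  + by regs; rewrite /f; case: (av g); lia.
  split=> //; split=> [h Hh|]; last by exists g; rewrite ?mset_eq //; lia.
  have -> : h = g by lia.
  by rewrite mset_eq.
- move=> lo l1 l2 M1 l10 l20 lm lE _ [P1 P2] [P3 P4]; rewrite /best_comb.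
  case: P2 => g1 H1 F1; case: P4 => g2 H2 F2.
  have b1 : f g1 <= m by apply: fm; lia.
  have b2 : f g2 <= m by apply: fm; lia.
  apply/wp_seq/(wp_fetch B2 Bw (4 * Z + s * m + lo) (f g1)) => //; try by side.
    by right; exists lo => //; lia.
  apply/wp_seq/(wp_fetch B2 Bw (4 * Z + s * m + (lo + l1)) (f g2)) => //; try by side.
    by right; exists (lo + l1) => //; lia.
  apply: (wp_store B2 Bw (4 * Z + s * m + lo) (minn (f g1) (f g2))) => //; try by side.
    by exists lo => //; lia.
  split=> //; rewrite /Post mset_eq //; split.
    move=> g Hg; case: (ltnP g (lo + l1)) => Hl.
      by have := P1 g; rewrite F1; lia.
    by have := P3 g; rewrite F2; lia.
  case: (leqP (f g1) (f g2)) => _; [exists g1|exists g2] => //; lia.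
- by move=> a [g Hg ->]; lia.
move=> rf' M' wk dp _ [-> [P1 P2] lw ld]; rewrite /= in lw ld; split=> //; try lia.
rewrite -[4 * Z + s * m]addn0; apply: minrankE => //.
by move=> g gm; exact: rank_ltn.
Qed.

Lemma rank_mem_frame M M' : (forall a, m <= a < 2 * Z -> M' a = M a) -> rank_mem M -> rank_mem M'.
Proof. by move=> E H j g jN gm; have := rank_row_le jN => jb; rewrite E ?H //; lia. Qed.

Lemma pow_mem_frame M M' : (forall a, m <= a < 2 * Z -> M' a = M a) -> pow_mem M -> pow_mem M'.
Proof. by move=> E H j jN; rewrite E ?H //; lia. Qed.

Lemma wp_state_avail rf M s :
  globals rf -> s < S -> rf 10 = s -> rank_mem M -> pow_mem M -> avail_mem s xpredT M ->
  wp (for_loop 14 $2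
       (Fetch 16 (pw_at $14) ;; 15 ::= $10 :/: $16 :%: $3 ;; tree_call 6 12 13 $1))
     rf M (fun a => a < 2 * Z) (fun a => 3 * Z + s * m <= a < 3 * Z + s * m + m)
     (fun rf' M' wk dp => [/\ rf' = rf, avail_mem s (avail s) M',
        wk <= N.+1 * (m * 400) & dp <= N.+1 * (K * 400)]).
Proof.
move=> G sS Es RM PM AM; have [[E0 E1 E2] [E3 E4 E5 E6]] := G; have sb := row_le sS.
pose av k g := all (fun i => digit m s i <= rk i g) (iota 0 k).
have H := @wp_for _ _ _ v w rr_program (8 * Z) B2 Bw 14 $2
  (Fetch 16 (pw_at $14) ;; 15 ::= $10 :/: $16 :%: $3 ;; tree_call 6 12 13 $1) rf M
  (fun a => a < 2 * Z) (fun a => 3 * Z + s * m <= a < 3 * Z + s * m + m)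
  N (fun k => avail_mem s (av k)) (m * 200 + 60) (K * 100 + 160).
apply: (wp_post (H _ _ _ _)); clear H => //; try by side.
- move=> j Mx jN Aj Fx; have jp := pow_le jN.
  have pj : m.+1 ^ j <= S by apply: leq_trans jp; rewrite leq_exp2l.
  have Fx' a : m <= a < 2 * Z -> Mx a = M a by move=> lt; apply: Fx; lia.
  apply/wp_seq/(wp_fetch B2 Bw (m + n + n * m + j) (m.+1 ^ j)) => //; try by side.
    exact: (pow_mem_frame Fx').
  apply/wp_seq/(wp_assign B2 Bw (digit m s j)).
  + by regs; have := leq_div s (m.+1 ^ j); repeat split; lia.
  + by regs.
  apply: (wp_conseq (wp_filter (s := s) (j := j) (d := digit m s j) (av := av j) _ sS _ jN _ _
            (rank_mem_frame Fx' RM) Aj)) => //.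
  + by move=> a; left; lia.
  move=> rf' M' wk dp _ [_ A' lw ld]; split; rewrite /=; try lia.
  move=> g gm; rewrite A' // /av -addn1 iotaD all_cat /= andbT; congr (nat_of_bool (_ && (_ <= _))).
move=> rf' M' wk dp _ [-> A' lw ld]; split=> //.
  by apply: leq_trans lw _; rewrite /= leq_mul2l; lia.
by apply: leq_trans ld _; rewrite /= leq_mul2l; lia.
Qed.

Lemma wp_state_round rf M s :
  globals rf -> s < S -> rf 10 = s -> rank_mem M -> pow_mem M ->
  avail_mem s (avail s) M -> M (5 * Z + s) = 0 ->
  wp (for_loop 14 $2
    (tree_call 5 12 13 $1 ;;
     Fetch 16 (best_at $10 #0) ;;
     15 ::= $16 :+: ($16 :<: $1) ;;
     Fetch 16 (pw_at $14) ;;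
     Fetch 17 (table_at #0 $10) ;;
     Store (table_at #0 $10) ($17 :+: $15 :*: $16) ;;
     tree_call 6 12 13 $1))
     rf M (fun a => a < 2 * Z)
     (fun a => [\/ 3 * Z + s * m <= a < 3 * Z + s * m + m,
                   4 * Z + s * m <= a < 4 * Z + s * m + m | a = 5 * Z + s])
     (fun rf' M' wk dp => [/\ rf' = rf, M' (5 * Z + s) = next_code s,
        wk <= N.+1 * (m * 800) & dp <= N.+1 * (K * 800)]).
Proof.
move=> G sS Es RM PM AM TM; have [[E0 E1 E2] [E3 E4 E5 E6]] := G; have sb := row_le sS.
set body := (X in for_loop _ _ X).
pose av := avail s.
pose Inv k M := avail_mem s (round_avail av k) M /\ M (5 * Z + s) = round_code av k.
have H := @wp_for _ _ _ v w rr_program (8 * Z) B2 Bw 14 $2 body rf M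
  (fun a => a < 2 * Z)
  (fun a => [\/ 3 * Z + s * m <= a < 3 * Z + s * m + m,
                   4 * Z + s * m <= a < 4 * Z + s * m + m | a = 5 * Z + s])
  N Inv (m * 400 + 160) (K * 200 + 360).
apply: (wp_post (H _ _ _ _)); clear H => //; try by side.
- by split=> //; rewrite TM /round_code big_nil.
- move=> j Mx jN [Aj Tj] Fx; have jp := pow_le jN.
  have pj : m.+1 ^ j <= S by apply: leq_trans jp; rewrite leq_exp2l.
  have Fx' a : m <= a < 2 * Z -> Mx a = M a by move=> lt; apply: Fx; case; lia.
  rewrite /body; apply: wp_seq.
  apply: (wp_conseq (wp_best (s := s) (j := j) (av := round_avail av j) _ sS _ jN _
            (rank_mem_frame Fx' RM) Aj)) => //.
  + by move=> a; constructor 2.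
  + by move=> a [?|?]; [left; lia|right; constructor 1].
  move=> rf1 M1 w1 d1 F1 [-> B1 lw1 ld1].
  have Bm := minrank_le_m m rk j (round_avail av j).
  have Dm := round_digit_le m rk av j.
  have CL := round_code_ltn m rk av j.
  (* The partial code stays below [m.+1 ^ j.+1], hence at most [S], so accumulating it cannot
     overflow. *)
  have CL' := round_code_ltn m rk av j.+1.
  have CS : round_code av j.+1 = round_code av j + round_digit m rk av j * m.+1 ^ j.
    by rewrite /round_code big_nat_recr.
  rewrite CS in CL'.
  have PM1 : M1 (m + n + n * m + j) = m.+1 ^ j.
    by rewrite F1 ?Fx' ?PM //; lia.
  have TM1 : M1 (5 * Z + s) = round_code av j by rewrite F1 ?Tj //; lia.
  apply/wp_seq/(wp_fetch B2 Bw (4 * Z + s * m) (minrank j (round_avail av j))) => //; try by side.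
    by right; constructor 2; lia.
  apply/wp_seq/(wp_assign B2 Bw (round_digit m rk av j)) => //; try by side.
  apply/wp_seq/(wp_fetch B2 Bw (m + n + n * m + j) (m.+1 ^ j)) => //; try by side.
  apply/wp_seq/(wp_fetch B2 Bw (5 * Z + s) (round_code av j)) => //; try by side.
    by right; constructor 3.
  apply/wp_seq/(wp_store B2 Bw (5 * Z + s) (round_code av j.+1)) => //; try by side.
    by constructor 3.
  have F2 a : m <= a < 2 * Z -> mset M1 (5 * Z + s) (round_code av j.+1) a = M a.
    by move=> lt; rewrite mset_neq ?F1 ?Fx' //; lia.
  apply: (wp_conseq (wp_filter (s := s) (j := j) (d := round_digit m rk av j)
      (av := round_avail av j) _ sS _ jN _ _ (rank_mem_frame F2 RM) _)) => //.
  + by move=> g gm; rewrite mset_neq ?F1 ?Aj //; lia.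
  + by move=> a; constructor 1.
  + by move=> a; left; lia.
  move=> rf' M' wk dp F3 [_ A' lw ld]; split; rewrite /=; try lia.
  by split=> //; rewrite F3 ?mset_eq //; lia.
move=> rf' M' wk dp _ [-> [_ T'] lw ld]; split=> //.
  by apply: leq_trans lw _; rewrite /= leq_mul2l; lia.
by apply: leq_trans ld _; rewrite /= leq_mul2l; lia.
Qed.

(** * Repeated squaring of the round *)

Definition table_mem (k : nat) (M : nat -> nat) : Prop :=
  forall s, s < S -> M (5 * Z + k * S + s) = iter (2 ^ k) next_code s.

Lemma wp_round rf M :
  globals rf -> rank_mem M -> pow_mem M -> S <= 2 ^ (K * N) ->
  wp (tree_call 3 10 11 $4) rf M (fun a => a < 2 * Z) (fun a => 3 * Z <= a < 5 * Z + S)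
     (fun rf' M' wk dp => [/\ rf' = rf, table_mem 0 M',
        wk <= S * (N * m * 4000) & dp <= K * N * 4000]).
Proof.
move=> G RM PM Se; have [[E0 E1 E2] [E3 E4 E5 E6]] := G.
pose Wr s a := [\/ 3 * Z + s * m <= a < 3 * Z + s * m + m,
                   4 * Z + s * m <= a < 4 * Z + s * m + m | a = 5 * Z + s].
have N1m : m <= N * m by rewrite leq_pmull.
have N1K : K <= K * N by rewrite leq_pmulr.
have H := @wp_pfor _ _ _ v w rr_program (8 * Z) B2 Bw 3 10 11 round_leaf rf M S (K * N) $4
  (fun a => a < 2 * Z) Wr (fun s M => M (5 * Z + s) = next_code s)
  (N * m * 3000) (K * N * 3000).
apply: (wp_conseq (H _ _ _ _ _ _ _ _ _ _ _)); clear H => //; try by side.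
- move=> s s' a sS sS'; have := row_le sS; have := row_le sS'.
  move=> b1 b2 [?|?|?] [?|?|?]; try lia.
    by case: (ltngtP s s') => // /(ltn_mul_row m); lia.
  by case: (ltngtP s s') => // /(ltn_mul_row m); lia.
- by move=> s a sS; have := row_le sS => sb [?|?|?]; lia.
- by move=> s M1 M2 _ E; rewrite E //; constructor 3.
- move=> s sS; have sb := row_le sS; rewrite /round_leaf.
  apply: wp_seq; apply: (wp_conseq (wp_init (s := s) _ _ sS _)) => //.
  + by move=> a; constructor 1.
  move=> rf1 M1 w1 d1 F1 [-> A1 lw1 ld1].
  have F1' a : m <= a < 2 * Z -> M1 a = M a by move=> lt; apply: F1; lia.
  apply: wp_seq; apply: (wp_conseq (wp_state_avail (s := s) _ sS _
      (rank_mem_frame F1' RM) (pow_mem_frame F1' PM) A1)) => //.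
  + by move=> a; constructor 1.
  + by move=> a; left.
  move=> rf2 M2 w2 d2 F2 [-> A2 lw2 ld2].
  apply/wp_seq/(wp_store B2 Bw (5 * Z + s) 0) => //; try by side.
    by constructor 3.
  have F3 a : m <= a < 2 * Z -> mset M2 (5 * Z + s) 0 a = M a.
    by move=> lt; rewrite mset_neq ?F2 ?F1' //; lia.
  apply: (wp_conseq (wp_state_round (s := s) _ sS _
      (rank_mem_frame F3 RM) (pow_mem_frame F3 PM) _ _)) => //.
  + by move=> g gm; rewrite mset_neq ?A2 //; lia.
  + by rewrite mset_eq.
  + by move=> a; left.
  move=> rf' M' wk dp _ [_ T' lw ld]; split=> //=; rewrite !mulSn in lw lw2 ld ld2.
    lia.
  lia.
- by move=> a [s Hs]; have := @row_le s; rewrite /Wr => sb [?|?|?]; lia.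
move=> rf' M' wk dp _ [-> HQ lw ld]; split=> //.
- by move=> s sS; rewrite mul0n addn0 HQ.
- have : S * 1 <= S * (N * m) by rewrite leq_mul2l muln_gt0 N0 m0 orbT.
  by rewrite /= in lw; lia.
- by rewrite /= in ld; lia.
Qed.

Lemma table_ltn k s : s < S -> iter k next_code s < S.
Proof. by case: k => [|k] //= _; rewrite SE next_ltn. Qed.

Let K_le : K <= Z. Proof. by apply: leq_trans Z_table; rewrite leq_pmulr. Qed.

Lemma wp_double_step rf M k :
  globals rf -> k.+1 < K -> rf 14 = k -> table_mem k M -> S <= 2 ^ (K * N) ->
  wp (tree_call 7 10 11 $4) rf M (fun a => 5 * Z <= a < 5 * Z + k.+1 * S)
     (fun a => 5 * Z + k.+1 * S <= a < 5 * Z + k.+2 * S)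
     (fun rf' M' wk dp => [/\ rf' = rf, table_mem k.+1 M',
        wk <= S * 120 & dp <= K * N * 120]).
Proof.
move=> [[E0 E1 E2] [E3 E4 E5 E6]] kK Ek TM Se.
have kS : k.+2 * S <= Z by apply: leq_trans Z_table; rewrite leq_mul2r kK orbT.
rewrite !mulSn in kS *.
have N1K : 1 <= K * N by rewrite muln_gt0 K0.
have H := @wp_pfor _ _ _ v w rr_program (8 * Z) B2 Bw 7 10 11 double_leaf rf M S (K * N) $4
  (fun a => 5 * Z <= a < 5 * Z + (S + k * S)) (fun s a => a = 5 * Z + (S + k * S) + s)
  (fun s M => M (5 * Z + (S + k * S) + s) = iter (2 ^ k.+1) next_code s) 60 60.
apply: (wp_conseq (H _ _ _ _ _ _ _ _ _ _ _)); clear H => //; try by side.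
- by move=> s M1 M2 _ E; rewrite E.
- move=> s sS; rewrite /double_leaf; have tS := table_ltn (2 ^ k) sS.
  apply/wp_seq/(wp_fetch B2 Bw (5 * Z + k * S + s) (iter (2 ^ k) next_code s)) => //; try by side.
    exact: TM.
  apply/wp_seq/(wp_fetch B2 Bw (5 * Z + k * S + iter (2 ^ k) next_code s)
                  (iter (2 ^ k.+1) next_code s)) => //; try by side.
    by rewrite TM // -iterD addnn -mul2n -expnS.
  apply: (wp_store B2 Bw (5 * Z + (S + k * S) + s) (iter (2 ^ k.+1) next_code s)) => //.
  + by regs; rewrite mulnDl mul1n; repeat split; lia.
  + by regs; rewrite mulnDl mul1n; lia.
  by split=> //; rewrite mset_eq.
- by move=> a [s Hs ->]; lia.
move=> rf' M' wk dp _ [-> HQ lw ld]; rewrite /= in lw ld; split=> //; try lia.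
Qed.

Lemma wp_double rf M :
  globals rf -> table_mem 0 M -> S <= 2 ^ (K * N) ->
  wp (for_loop 14 ($6 :-: #1) (tree_call 7 10 11 $4)) rf M
     (fun a => 5 * Z <= a < 5 * Z + S)
     (fun a => 5 * Z + S <= a < 6 * Z)
     (fun rf' M' wk dp => [/\ rf' = rf, forall k, k < K -> table_mem k M',
        wk <= K * (S * 200) & dp <= K * (K * N * 200)]).
Proof.
move=> G TM Se; have [[E0 E1 E2] [E3 E4 E5 E6]] := G.
have N1K : 1 <= K * N by rewrite muln_gt0 K0.
have H := @wp_for _ _ _ v w rr_program (8 * Z) B2 Bw 14 ($6 :-: #1) (tree_call 7 10 11 $4) rf M
  (fun a => 5 * Z <= a < 5 * Z + S) (fun a => 5 * Z + S <= a < 6 * Z) (K - 1)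
  (fun k M => forall k', k' <= k -> table_mem k' M) (S * 120) (K * N * 120).
apply: (wp_post (H _ _ _ _)); clear H => //; try by side.
- by move=> k'; rewrite leqn0 => /eqP->.
- move=> k Mx kK Tk Fx.
  have kS : k.+2 * S <= Z by apply: leq_trans Z_table; rewrite leq_mul2r; apply/orP; right; lia.
  rewrite !mulSn in kS.
  apply: (wp_conseq (wp_double_step (k := k) _ _ _ (Tk k _) _)) => //.
  + by lia.
  + by move=> a; rewrite !mulSn; lia.
  + by move=> a; rewrite !mulSn; lia.
  move=> rf' M' wk dp F [_ T' lw ld]; split=> // k'; rewrite leq_eqVlt => /orP[/eqP->//|k'k].
  move=> s sS; have k'S : k'.+1 * S <= k.+1 * S by rewrite leq_mul2r k'k orbT.
  by rewrite F ?Tk //; move: k'S; rewrite !mulSn; lia.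
move=> rf' M' wk dp _ [-> HQ lw ld]; rewrite /= subn1 prednK // in lw ld; split=> //.
- by move=> k kK; apply: HQ; lia.
- by apply: leq_trans lw _; rewrite leq_mul2l; lia.
- by apply: leq_trans ld _; rewrite leq_mul2l; lia.
Qed.

(** * Finding the owner of each good *)

Lemma wp_flag rf M g s :
  globals rf -> g < m -> rf 10 = g -> s < S -> rf 17 = s -> rank_mem M -> pow_mem M ->
  M (7 * Z + g) = 1 ->
  wp (for_loop 14 $2
       (Fetch 18 (pw_at $14) ;;
        18 ::= $17 :/: $18 :%: $3 ;;
        Fetch 19 (rank_at $14 $10) ;;
        Fetch 20 (flag_at $10) ;;
        Store (flag_at $10) ($20 :*: (#1 :-: ($19 :<: $18)))))
     rf M (fun a => m <= a < 2 * Z) (fun a => a = 7 * Z + g)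
     (fun rf' M' wk dp => [/\ rf' = rf, M' (7 * Z + g) = avail s g,
        wk <= N * 200 & dp <= N * 200]).
Proof.
move=> G gm Eg sS Es RM PM FM; have [[E0 E1 E2] [E3 E4 E5 E6]] := G.
set body := (X in for_loop _ _ X).
pose av k := all (fun i => digit m s i <= rk i g) (iota 0 k).
have H := @wp_for _ _ _ v w rr_program (8 * Z) B2 Bw 14 $2 body rf M
  (fun a => m <= a < 2 * Z) (fun a => a = 7 * Z + g)
  N (fun k M => M (7 * Z + g) = av k) 70 70.
apply: (wp_post (H _ _ _ _)); clear H => //; try by side.
- move=> j Mx jN Aj Fx; have jp := pow_le jN; have jb := rank_row_le jN.
  have pj : m.+1 ^ j <= S by apply: leq_trans jp; rewrite leq_exp2l.
  have Fx' a : m <= a < 2 * Z -> Mx a = M a by move=> lt; apply: Fx; lia.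
  apply/wp_seq/(wp_fetch B2 Bw (m + n + n * m + j) (m.+1 ^ j)) => //; try by side.
    exact: (pow_mem_frame Fx').
  apply/wp_seq/(wp_assign B2 Bw (digit m s j)).
  + by regs; have := leq_div s (m.+1 ^ j); repeat split; lia.
  + by regs.
  apply/wp_seq/(wp_fetch B2 Bw (Z + j * m + g) (rk j g)) => //; try by side.
    exact: (rank_mem_frame Fx').
  apply/wp_seq/(wp_fetch B2 Bw (7 * Z + g) (av j)) => //; try by side.
  have avS : av j.+1 = av j && (digit m s j <= rk j g).
    by rewrite /av -addn1 iotaD all_cat /= andbT.
  apply: (wp_store B2 Bw (7 * Z + g) (av j.+1)) => //; try by side.
  by split=> //; rewrite mset_eq.
move=> rf' M' wk dp _ [-> A' lw ld]; rewrite /= mulSn in lw ld; split=> //; lia.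
Qed.

Hypothesis exhausted : forall t g, g < m -> m <= t -> avail (iter t next_code 0) g = false.

Lemma wp_lift rf M g :
  globals rf -> g < m -> rf 10 = g -> rank_mem M -> pow_mem M ->
  (forall k, k < K -> table_mem k M) -> M (6 * Z + g) = 0 ->
  wp (for_loop 12 $6
    (Fetch 16 (pos_at $10) ;;
     Fetch 17 (table_at ($6 :-: #1 :-: $12) $16) ;;
     Store (flag_at $10) #1 ;;
     for_loop 14 $2
       (Fetch 18 (pw_at $14) ;;
        18 ::= $17 :/: $18 :%: $3 ;;
        Fetch 19 (rank_at $14 $10) ;;
        Fetch 20 (flag_at $10) ;;
        Store (flag_at $10) ($20 :*: (#1 :-: ($19 :<: $18)))) ;;
     Fetch 18 (flag_at $10) ;;
     Store (pos_at $10) ($18 :*: $17 :+: (#1 :-: $18) :*: $16)))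
     rf M (fun a => m <= a < 2 * Z \/ 5 * Z <= a < 6 * Z)
     (fun a => a = 6 * Z + g \/ a = 7 * Z + g)
     (fun rf' M' wk dp => [/\ rf' = rf,
        exists t, [/\ M' (6 * Z + g) = iter t next_code 0,
          avail (iter t next_code 0) g & ~~ avail (iter t.+1 next_code 0) g],
        wk <= K * (N * 800) & dp <= K * (N * 800)]).
Proof.
move=> G gm Eg RM PM TM M0; have [[E0 E1 E2] [E3 E4 E5 E6]] := G.
set body := (X in for_loop _ _ X).
(* The good disappears within the [2 ^ (K - x)] rounds after [t]. Initially this holds since
   [2 ^ K > m] rounds exhaust the goods; each pass halves the window, down to a single round. *)
pose Inv x (M : nat -> nat) := exists t, [/\ M (6 * Z + g) = iter t next_code 0,
          avail (iter t next_code 0) g & ~~ avail (iter (t + 2 ^ (K - x)) next_code 0) g].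
have H := @wp_for _ _ _ v w rr_program (8 * Z) B2 Bw 12 $6 body rf M
  (fun a => m <= a < 2 * Z \/ 5 * Z <= a < 6 * Z) (fun a => a = 6 * Z + g \/ a = 7 * Z + g)
  K Inv (N * 200 + 100) (N * 200 + 100).
apply: (wp_post (H _ _ _ _)); clear H => //; try by side.
- by exists 0; rewrite avail0 subn0 exhausted //; lia.
- move=> x Mx xK [t [Ht at0 nat1]] Fx.
  have Fx' a : m <= a < 2 * Z -> Mx a = M a by move=> lt; apply: Fx; lia.
  have tS : iter t next_code 0 < S by apply: table_ltn.
  have [k [Ek kK EkS]] : exists k, [/\ K - 1 - x = k, k < K & K - x = k.+1].
    by exists (K - 1 - x); split; lia.
  have kS := ltn_mul_row S kK.
  set p := iter t next_code 0 in Ht at0 tS.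
  set q := iter (t + 2 ^ k) next_code 0.
  have qS : q < S by apply: table_ltn.
  rewrite /body; apply/wp_seq/(wp_fetch B2 Bw (6 * Z + g) p) => //; try by side.
  apply/wp_seq/(wp_fetch B2 Bw (5 * Z + k * S + p) q) => //.
  + by regs; rewrite Ek; repeat split; lia.
  + by regs; rewrite Ek.
  + rewrite Fx; last by lia.
    by rewrite TM // /q addnC iterD.
  + by left; right; lia.
  apply/wp_seq/(wp_store B2 Bw (7 * Z + g) 1) => //; try by side.
  have F2 a : m <= a < 2 * Z -> mset Mx (7 * Z + g) 1 a = M a.
    by move=> lt; rewrite mset_neq ?Fx' //; lia.
  apply: wp_seq; apply: (wp_conseq (wp_flag (g := g) (s := q) _ gm _ qS _
    (rank_mem_frame F2 RM) (pow_mem_frame F2 PM) _)) => //.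
  + by rewrite mset_eq.
  + by move=> a; right.
  + by move=> a; left; left.
  move=> rf' M' wk dp F3 [-> A' lw ld].
  apply/wp_seq/(wp_fetch B2 Bw (7 * Z + g) (avail q g)) => //; try by side.
  apply: (wp_store B2 Bw (6 * Z + g) (if avail q g then q else p)) => //.
  + by side.
  + by regs; case: (avail q g); repeat split; lia.
  + by regs.
  + by regs; case: (avail q g); lia.
  + by left.
  split=> /=; try lia; rewrite /Inv.
  have -> : K - x.+1 = k by lia.
  case: ifPn => aq.
    exists (t + 2 ^ k); rewrite mset_eq //; split=> //.
    by rewrite -addnA addnn -mul2n -expnS -EkS.
  by exists t; rewrite mset_eq.
move=> rf' M' wk dp _ [-> [t [Ht at0 nat1]] lw ld]; rewrite subnn expn0 addn1 in nat1.
have h1 : N <= K * N by rewrite leq_pmull.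
have h2 : K <= K * N by rewrite leq_pmulr.
rewrite /= mulSn in lw ld; split=> //; try lia.
by exists t.
Qed.

Lemma wp_find_owner rf M g s (j : 'I_n) :
  globals rf -> g < m -> rf 10 = g -> s < S -> rf 17 = s ->
  input_mem M -> rank_mem M -> pow_mem M ->
  j < N -> rk j g < digit m s j -> (forall i, i < j -> digit m s i <= rk i g) ->
  wp (for_loop 12 $2
    (14 ::= $2 :-: #1 :-: $12 ;;
     Fetch 18 (pw_at $14) ;;
     18 ::= $17 :/: $18 :%: $3 ;;
     Fetch 19 (rank_at $14 $10) ;;
     If ($19 :<: $18) (Fetch 20 ($1 :+: $14) ;; Store $10 $20) Skip))
     rf M (fun a => m <= a < 2 * Z) (fun a => a = g)
     (fun rf' M' wk dp => [/\ rf' = rf, M' g = sigma j,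
        wk <= N * 200 & dp <= N * 200]).
Proof.
move=> G gm Eg sS Es [IM _] RM PM jN Hj Hlt; have [[E0 E1 E2] [E3 E4 E5 E6]] := G.
set body := (X in for_loop _ _ X).
(* Pass [x] inspects position [N - 1 - x]. Positions above [j] may write first, so the invariant
   speaks only once [j] has been visited; the positions below [j] do not write. *)
have H := @wp_for _ _ _ v w rr_program (8 * Z) B2 Bw 12 $2 body rf M
  (fun a => m <= a < 2 * Z) (fun a => a = g)
  N (fun x M => N - x <= j -> M g = sigma j) 70 70.
apply: (wp_post (H _ _ _ _)); clear H => //; try by side.
- move=> x Mx xN Ij Fx.
  have [i [Ei iN Exi]] : exists i, [/\ N - 1 - x = i, i < N & N - x = i.+1].
    by exists (N - 1 - x); split; lia.
  have Exi' : N - x.+1 = i by lia.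
  have ip := pow_le iN; have ib := rank_row_le iN.
  have pi_le : m.+1 ^ i <= S by apply: leq_trans ip; rewrite leq_exp2l.
  have Fx' a : m <= a < 2 * Z -> Mx a = M a by move=> lt; apply: Fx; lia.
  rewrite Exi'; apply/wp_seq/(wp_assign B2 Bw i) => //; try by side.
  apply/wp_seq/(wp_fetch B2 Bw (m + n + n * m + i) (m.+1 ^ i)) => //; try by side.
    exact: (pow_mem_frame Fx').
  apply/wp_seq/(wp_assign B2 Bw (digit m s i)).
  + by regs; have := leq_div s (m.+1 ^ i); repeat split; lia.
  + by regs.
  apply/wp_seq/(wp_fetch B2 Bw (Z + i * m + g) (rk i g)) => //; try by side.
    exact: (rank_mem_frame Fx').
  apply: (wp_if B2 Bw); first by side.
  rewrite [eval_nat _ _]/= eqb0 negbK; case: ltnP => Hi.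
    have in' : i < n by lia.
    have EM : Mx (m + i) = sigma (Ordinal in') by rewrite Fx' ?(IM (Ordinal in')) //; lia.
    apply/wp_seq/(wp_fetch B2 Bw (m + i) (sigma (Ordinal in'))) => //; try by side.
    apply: (wp_store B2 Bw g (sigma (Ordinal in'))) => //; try by side.
    split=> // ij; rewrite mset_eq //.
    have -> // : Ordinal in' = j.
    apply: val_inj => /=; case: (ltngtP i j) => // lt; last by lia.
    by have := Hlt i lt; rewrite leqNgt Hi.
  apply: wp_skip; split=> // ij; apply: Ij; rewrite Exi ltn_neqAle ij andbT.
  by apply: contraL Hi => /eqP->; rewrite -ltnNge.
move=> rf' M' wk dp _ [-> A' lw ld]; rewrite /= mulSn in lw ld; split=> //; try lia.
Qed.

Definition taken_by (g t : nat) (j : 'I_n) : Prop :=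
  [/\ avail (iter t next_code 0) g, ~~ avail (iter t.+1 next_code 0) g, j < N,
      rk j g < digit m (iter t.+1 next_code 0) j &
      forall i, i < j -> digit m (iter t.+1 next_code 0) i <= rk i g].

Lemma taken_by_ex g t : avail (iter t next_code 0) g -> ~~ avail (iter t.+1 next_code 0) g ->
  exists j, taken_by g t j.
Proof.
move=> a0 a1; have := a1; rewrite -has_predC => /hasP ex.
have {}ex : exists j, (j < N) && (rk j g < digit m (iter t.+1 next_code 0) j).
  by case: ex => j; rewrite mem_iota /= -ltnNge => jN H; exists j; rewrite jN.
case: (ex_minnP ex) => j /andP[jN Hj] Hmin.
exists (Ordinal (leq_trans jN Nn)); split=> // i /= ij.
by rewrite leqNgt; apply/negP => Hi; have := Hmin i; rewrite Hi; lia.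
Qed.

Lemma wp_owner rf M :
  globals rf -> input_mem M -> rank_mem M -> pow_mem M ->
  (forall k, k < K -> table_mem k M) ->
  wp (tree_call 8 10 11 $1) rf M (fun a => m <= a < 2 * Z \/ 5 * Z <= a < 6 * Z)
     (fun a => a < m \/ 6 * Z <= a < 8 * Z)
     (fun rf' M' wk dp => [/\ rf' = rf,
        forall g, g < m -> exists t j, taken_by g t j /\ M' g = sigma j,
        wk <= m * (K * N * 1200) & dp <= K * N * 1200]).
Proof.
move=> G IM RM PM TM; have [[E0 E1 E2] [E3 E4 E5 E6]] := G.
pose Wr g a := [\/ a = g, a = 6 * Z + g | a = 7 * Z + g].
have h1 : N <= K * N by rewrite leq_pmull.
have h2 : K <= K * N by rewrite leq_pmulr.
have H := @wp_pfor _ _ _ v w rr_program (8 * Z) B2 Bw 8 10 11 owner_leaf rf M m K $1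
  (fun a => m <= a < 2 * Z \/ 5 * Z <= a < 6 * Z) Wr
  (fun g M => exists t j, taken_by g t j /\ M g = sigma j)
  (K * N * 1100) (K * N * 1100).
apply: (wp_conseq (H _ _ _ _ _ _ _ _ _ _ _)); clear H => //; try by side.
- by move=> g g' a gm gm' [?|?|?] [?|?|?]; lia.
- by move=> g a gm [?|?|?]; lia.
- by move=> g M1 M2 _ E [t [j [T Ej]]]; exists t, j; rewrite -E //; constructor 1.
- move=> g gm; rewrite /owner_leaf.
  apply/wp_seq/(wp_store B2 Bw (6 * Z + g) 0) => //; try by side.
    by constructor 2.
  set M1 := mset _ _ _.
  have F1 a : m <= a < 6 * Z -> M1 a = M a by move=> lt; rewrite /M1 mset_neq //; lia.
  have F1' a : m <= a < 2 * Z -> M1 a = M a by move=> lt; apply: F1; lia.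
  apply: wp_seq; apply: (wp_conseq (wp_lift (g := g) _ gm _
     (rank_mem_frame F1' RM) (pow_mem_frame F1' PM) _ _)) => //.
  + move=> k kK s sS; have kS := ltn_mul_row S kK; rewrite F1 ?TM //; lia.
  + by rewrite /M1 mset_eq.
  + by move=> a [?|?]; [constructor 2|constructor 3].
  + by move=> a; left.
  move=> rf2 M2 w2 d2 F2 [-> [t [Ht at0 nat1]] lw2 ld2].
  have [j Tj] := taken_by_ex at0 nat1.
  have F2' a : m <= a < 6 * Z -> M2 a = M a by move=> lt; rewrite F2 ?F1 //; lia.
  have F2'' a : m <= a < 2 * Z -> M2 a = M a by move=> lt; apply: F2'; lia.
  have tS : iter t next_code 0 < S by apply: table_ltn.
  have tS' : iter t.+1 next_code 0 < S by apply: table_ltn.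
  apply/wp_seq/(wp_fetch B2 Bw (6 * Z + g) (iter t next_code 0)) => //; try by side.
    by right; constructor 2.
  apply/wp_seq/(wp_fetch B2 Bw (5 * Z + iter t next_code 0) (iter t.+1 next_code 0)) => //; try by side.
    rewrite F2'; last by lia.
    by have := TM 0 K0 _ tS; rewrite mul0n addn0.
  have [_ _ jN Hj Hlt] := Tj.
  apply: (wp_conseq (wp_find_owner (g := g) (s := iter t.+1 next_code 0) (j := j) _ gm _ tS' _ _
     (rank_mem_frame F2'' RM) (pow_mem_frame F2'' PM) jN Hj Hlt)) => //.
  + case: IM => I1 I2; split=> [k|i h]; rewrite F2' ?I1 ?I2 //.
      by have := ltn_ord k; lia.
    by have := ltn_mul_row m (ltn_ord i); have := ltn_ord h; lia.
  + by move=> a ->; constructor 1.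
  + by move=> a; left; left.
  move=> rf3 M3 w3 d3 _ [_ E3' lw3 ld3]; split; rewrite /=; try lia.
  by exists t, j.
- by move=> a [g Hg [?|?|?]]; lia.
move=> rf' M' wk dp _ [-> HQ lw ld]; split=> //; rewrite /= in lw ld; try lia.
have : m * 1 <= m * (K * N) by rewrite leq_mul2l muln_gt0 K0 N0 orbT.
lia.
Qed.

(** * Assembling the phases *)

Hypotheses (NE : N = minn n m) (K_tight : 2 ^ K.-1 <= m)
  (ZE : Z = S * m.+1 + (n + 2) * (m + 2) * (m + 2)).

(** The bounds [2 ^ K.-1 <= m < 2 ^ K] ensure that the doubling loop stops at [K] and not earlier;
    [t] is the number of doublings left. *)
Lemma wp_log rf M Sh Wr k t :
  k + t = K -> rf 1 = m -> rf 6 = k -> rf 7 = 2 ^ k ->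
  wp (While ($7 :<: $1 :+: #1) (7 ::= $7 :*: #2 ;; 6 ::= $6 :+: #1)) rf M Sh Wr
     (fun rf' M' wk dp => [/\ M' = M, rf' 6 = K, forall r, r < 6 -> rf' r = rf r,
        wk <= t * 30 + 10 & dp <= t * 30 + 10]).
Proof.
elim: t k rf => [|t IH] k rf.
  rewrite addn0 => Ek E1 E6 E7; rewrite Ek in E6 E7.
  apply: (wp_while_end B2 Bw); try by side.
move=> kK E1 E6 E7.
have le : 2 ^ k <= m by apply: leq_trans K_tight; rewrite leq_exp2l //; lia.
apply: (wp_while_loop B2 Bw); first by side.
  by regs; rewrite eqb0 negbK addn1 ltnS.
have kS : k < 2 ^ k by apply: ltn_expl.
apply/wp_seq/(wp_assign B2 Bw (2 ^ k.+1)).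
- by side.
- by regs; rewrite expnSr.
apply: (wp_assign B2 Bw k.+1) => //; try by side.
apply: (wp_post (IH k.+1 _ _ _ _ _)) => //; first by lia.
move=> rf' M' wk dp _ [-> h1 h2 h3 h4]; split=> //=; try lia.
move=> r r6; rewrite h2 // /upd; case: eqnP => [|_]; first by lia.
by case: eqnP => //; lia.
Qed.

Lemma wp_powers rf M : rf 0 = n -> rf 1 = m -> rf 2 = N -> rf 3 = m.+1 ->
  M (m + n + n * m) = 1 ->
  wp (for_loop 10 $2
       (Fetch 16 (pw_at $10) ;; Store (pw_at ($10 :+: #1)) ($16 :*: $3)))
     rf M (fun=> False) (fun a => m + n + n * m <= a <= m + n + n * m + N)
     (fun rf' M' wk dp => [/\ rf' = rf,
        forall j, j <= N -> M' (m + n + n * m + j) = m.+1 ^ j,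
        wk <= N * 200 & dp <= N * 200]).
Proof.
move=> E0 E1 E2 E3 M0.
set body := (X in for_loop _ _ X).
have H := @wp_for _ _ _ v w rr_program (8 * Z) B2 Bw 10 $2 body rf M
  (fun=> False) (fun a => m + n + n * m <= a <= m + n + n * m + N)
  N (fun k M => forall j, j <= k -> M (m + n + n * m + j) = m.+1 ^ j) 70 70.
apply: (wp_post (H _ _ _ _)); clear H => //; try by side.
- by move=> j; rewrite leqn0 => /eqP->; rewrite addn0 expn0.
- move=> k Mx kN Ik _; have kp := pow_le kN.
  apply/wp_seq/(wp_fetch B2 Bw (m + n + n * m + k) (m.+1 ^ k)) => //; try by side.
    exact: Ik.
  apply: (wp_store B2 Bw (m + n + n * m + k.+1) (m.+1 ^ k.+1)) => //.
  + by side.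
  + by regs; rewrite -expnSr; repeat split; lia.
  + by side.
  + by regs; rewrite expnSr.
  + by lia.
  split=> // j; rewrite leq_eqVlt => /orP[/eqP->|jk]; first by rewrite mset_eq.
  by rewrite mset_neq ?Ik //; lia.
by move=> rf' M' wk dp _ [-> A' lw ld]; rewrite /= mulSn in lw ld; split=> //; lia.
Qed.

Lemma wp_main rf M : rf 0 = n -> rf 1 = m -> input_mem M ->
  wp main_proc rf M (fun=> False) (fun=> True)
    (fun _ M' wk dp => [/\
       forall g, g < m -> exists t j, taken_by g t j /\ M' g = sigma j,
       wk <= S * (N * m) * (100 * 100) & dp <= K * N * K * (100 * 100)]).
Proof.
move=> E0 E1 IM.
have h1 : N <= K * N by rewrite leq_pmull.
have h2 : K <= K * N by rewrite leq_pmulr.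
have NmS : N * m < S by rewrite SE; exact: bernoulli.
have mNm : m <= N * m by rewrite leq_pmull.
have b2K : m.+1 <= 2 ^ K by [].
(* Each of the [N] digits fits in [K] bits, which bounds the height of the fork trees over the
   states. *)
have Se : S <= 2 ^ (K * N) by rewrite SE expnM leq_exp2r.
have Ne : N * m <= 2 ^ (K * N) by lia.
have q1 : (n + 2) * (m + 2) <= Z.
  rewrite ZE; apply: leq_trans (leq_addl _ _); rewrite leq_pmulr //; lia.
apply: (wp_if B2 Bw) => //; rewrite /= E1 -lt0n m0.
apply/wp_seq/(wp_assign B2 Bw N) => //; try by side.
apply/wp_seq/(wp_assign B2 Bw m.+1) => //; try by side.
apply/wp_seq/(wp_store B2 Bw (m + n + n * m) 1) => //; try by side.
apply: wp_seq; apply: (wp_conseq (wp_powers _ _ _ _ _)) => //; try by regs.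
  by rewrite mset_eq.
move=> rf1 M1 w1 d1 F1 [-> P1 lw1 ld1].
apply/wp_seq/(wp_fetch B2 Bw (m + n + n * m + N) S) => //; try by side.
  by rewrite P1 // SE.
apply/wp_seq/(wp_assign B2 Bw Z) => //; try by side.
apply/wp_seq/(wp_assign B2 Bw 0) => //; try by side.
apply/wp_seq/(wp_assign B2 Bw 1) => //; try by side.
apply: wp_seq; apply: (wp_post (@wp_log _ M1 _ _ 0 K _ _ _ _)) => //; try by regs.
move=> rf2 M2 w2 d2 _ [-> E6 R2 lw2 ld2].
have G : globals rf2 by split; split=> //; rewrite R2 //; regs.
have F1' a : a < m + n + n * m -> M1 a = M a.
  by move=> lt; rewrite F1 ?mset_neq //; lia.
have I1 : input_mem M1.
  case: IM => I1 I2; split=> [k|i h]; rewrite F1' ?I1 ?I2 //.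
    by have := ltn_ord k; lia.
  by have := ltn_mul_row m (ltn_ord i); have := ltn_ord h; lia.
have PM1 : pow_mem M1 by move=> j jN; apply: P1; exact: ltnW.
apply: wp_seq; apply: (wp_conseq (wp_rank G I1 Ne)) => //; first by right.
move=> rf3 M3 w3 d3 F3 [-> RM3 lw3 ld3].
have PM3 : pow_mem M3 by move=> j jN; rewrite F3 ?PM1 //; lia.
apply: wp_seq; apply: (wp_conseq (wp_round G RM3 PM3 Se)) => //; first by right.
move=> rf4 M4 w4 d4 F4 [-> TM4 lw4 ld4].
apply: wp_seq; apply: (wp_conseq (wp_double G TM4 Se)) => //; first by right.
move=> rf5 M5 w5 d5 F5 [-> TM5 lw5 ld5].
have F a : a < Z -> M5 a = M1 a.
  by move=> lt; rewrite F5 ?F4 ?F3 //; lia.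
have F' a : m <= a < 2 * Z -> M5 a = M3 a.
  by move=> lt; rewrite F5 ?F4 //; lia.
have I5 : input_mem M5.
  case: I1 => I1 I2; split=> [k|i h]; rewrite F ?I1 ?I2 //.
    by have := ltn_ord k; lia.
  by have := ltn_mul_row m (ltn_ord i); have := ltn_ord h; lia.
apply: (wp_conseq (wp_owner G I5 (rank_mem_frame F' RM3) (pow_mem_frame F' PM3) TM5)) => //.
  by right.
move=> rf6 M6 w6 d6 _ [_ HQ lw6 ld6]; split=> //.
  (* All phases are charged to the [N * m * S] of the tabulation: the squarings by [K <= m], the
     ranks by [m <= S], and the search for owners by both. *)
  have km : K <= m by apply: leq_trans K_tight; have := ltn_expl K.-1 (isT : 1 < 2); lia.
  have KS : K * S <= N * m * S by rewrite leq_mul2r (leq_trans km mNm) orbT.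
  have mm : N * m * m <= N * m * S by rewrite leq_mul2l; apply/orP; right; lia.
  have mk : m * (K * N) <= N * m * S.
    by apply: leq_trans mm; have := leq_mul km (leqnn (N * m)); lia.
  have one : 1 <= N * m * S by rewrite !muln_gt0 N0 m0.
  have NS : N <= N * m * S by apply: leq_trans (leq_pmulr _ _); rewrite ?leq_pmulr.
  have KS1 : K <= N * m * S by apply: leq_trans KS; rewrite leq_pmulr.
  by rewrite /= !(mulnA, mulnDr) in lw1 lw2 lw3 lw4 lw5 lw6 *; lia.
(* The squarings dominate the depth; every other phase is [O(K * N)]. *)
have KNK : K * N <= K * N * K by rewrite leq_pmulr.
by rewrite /=; lia.
Qed.

End Program.

(** * Bounds *)

(** For [k < m] this is [(1 + 1/m)^k <= 1 / (1 - k/m)] with the denominators cleared. *)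
Lemma bernoulli_pred m k : m.+1 ^ k * (m - k) <= m ^ k * m.
Proof.
elim: k => [|k IH]; first by rewrite !expn0 subn0.
have [km|km] := leqP m k.+1.
  have -> : m - k.+1 = 0 by lia.
  by rewrite muln0.
rewrite !expnS -!mulnA [m * (m ^ k * m)]mulnC; apply: leq_trans (leq_mul IH (leqnn m)).
rewrite -mulnA mulnCA leq_mul2l; apply/orP; right; nia.
Qed.

Lemma expnS_base_half m k : 0 < m -> k.*2 <= m -> m.+1 ^ k <= 2 * m ^ k.
Proof.
move=> m0 km; rewrite -(leq_pmul2r m0).
have := bernoulli_pred m k.
have : m <= 2 * (m - k) by lia.
move/(leq_mul (leqnn (m.+1 ^ k))) => h1 h2; lia.
Qed.

(* The number of states is [O(m ^ N)] because only [N = min n m] agents are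
   simulated; for [n] agents it would be [(m + 1) ^ n]. *)
Lemma expnS_base m N : 0 < m -> N <= m -> m.+1 ^ N <= 8 * m ^ N.
Proof.
move=> m0 Nm; have H := @expnS_base_half m N./2 m0.
have {}H : m.+1 ^ N./2 <= 2 * m ^ N./2 by apply: H; lia.
have HH := leq_mul H H.
(* The constant 8 is a factor 2 for each half of the exponent and one more for the odd remainder. *)
rewrite -[N in _ ^ N]odd_double_half -[N in _ <= _ * _ ^ N]odd_double_half.
rewrite -addnn !expnD.
have ob : m.+1 ^ odd N <= 2 * m ^ odd N by case: odd; rewrite ?expn0 ?expn1; lia.
by have := leq_mul ob HH; lia.
Qed.

(** With [q = n * K] the summands are at most [2 ^ (2 * q)] and [2 ^ (6 * q)], so eight times their
    sum is at most [2 ^ (6 * q + 4)]. As [q >= 1], the exponent [6 * q + 4] is below [11 * q]. *)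
Lemma word_capacity n m N K w : 0 < n -> N <= n -> 0 < K -> m < 2 ^ K ->
  11 * (n * K) <= w ->
  8 * (m.+1 ^ N * m.+1 + (n + 2) * (m + 2) * (m + 2)) < 2 ^ w.
Proof.
move=> n0 Nn K0 mK hw; set q := n * K in hw.
have nq : n <= q by rewrite leq_pmulr.
have Kq : K <= q by rewrite leq_pmull.
have e2 a b : a <= b -> 2 ^ a <= 2 ^ b by rewrite leq_exp2l.
have h1 : m.+1 ^ N <= 2 ^ q.
  apply: leq_trans (e2 (K * N) q _); first by rewrite expnM; case: (N) => [//|k]; rewrite leq_exp2r.
  by rewrite mulnC leq_mul2r Nn orbT.
have h2 : m.+1 <= 2 ^ q by apply: leq_trans mK _; exact: e2.
have h3 : n + 2 <= 2 ^ (2 * q).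
  apply: leq_trans (e2 n.+1 (2 * q) _); last by lia.
  by rewrite expnS; have := ltn_expl n (isT : 1 < 2); lia.
have h4 : m + 2 <= 2 ^ (2 * q).
  by apply: leq_trans (e2 q.+1 (2 * q) _); [rewrite expnS; lia | lia].
have h5 := leq_mul h1 h2; have h6 := leq_mul (leq_mul h3 h4) h4.
rewrite -!expnD in h5 h6.
have h7 : 2 ^ (q + q) <= 2 ^ (6 * q) by apply: e2; lia.
have h8 : 2 ^ (2 * q + 2 * q + 2 * q) <= 2 ^ (6 * q) by apply: e2; lia.
have h9 : 2 ^ 4 * 2 ^ (6 * q) < 2 ^ w by rewrite -expnD ltn_exp2l //; lia.
rewrite -[2 ^ 4]/16 in h9; lia.
Qed.

(** Words of [O(n log m)] bits are what addresses of order [(m + 1) ^ N] require. The costs are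
    stated for [2 <= m] because the logarithm vanishes at [m = 1]. *)
Theorem theorem29 :
  exists (P : program) (cD cW cB : nat),
    forall (R : realFieldType) (n m : nat) (v : 'I_n -> 'I_m -> R)
           (pi : 'I_n -> seq 'I_m) (tb : 'I_n -> 'I_m -> 'I_m)
           (sigma : {perm 'I_n}),
      0 < n ->
      (forall i g, (0 <= v i g)%R) ->
      (forall i, pref_list (v i) (pi i)) ->
      (forall i, breaks_ties (v i) (tb i) (pi i)) ->
      EF1 v (round_robin pi sigma) /\
      forall (w : nat) (rf M : nat -> nat),
        cB * (n * (trunc_log 2 m).+1) <= w ->
        is_input sigma tb rf M ->
        exists o : outcome,
          [/\ exec v w P (Call 0) rf M o,
              is_output (round_robin pi sigma) (omem o) &
              2 <= m ->
                odepth o <= cD * (n ^ 2 * trunc_log 2 m ^ 2) /\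
                owork o <= cW * (n * m ^ n.+1)].
Proof.
(* From [K <= 2 * L] the depth gains a factor 4, and from [S <= 8 * m ^ n] the work a factor 8; one
   more unit in each covers the initial [Call]. *)
exists rr_program, (100 * 100 * 5), (100 * 100 * 9), 11.
move=> R n m v pi tb sigma n0 v0 pi_pref pi_ties; split; first exact: round_robin_EF1.
move=> w rf M hw [E0 E1 Is It].
have [m0|m0] := posnP m.
  have Ew : eval w rf (Reg 1) = Some 0 by rewrite /= E1 m0.
  have ex : exec v w rr_program (Call 0) rf M
      (tick 1 (tick (expr_size (Reg 1)).+1 (Outcome rf M [::] [::] 1 1))).
    apply: (@exec_Call _ _ _ _ _ _ 0 main_proc) => //.
    by apply: (exec_If Ew); exact: exec_Skip.
  eexists; split; [exact: ex | | by rewrite m0].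
  by move=> i g; have := ltn_ord g; rewrite {2}m0.
set L := trunc_log 2 m in hw *; set K := L.+1 in hw.
pose N := minn n m; pose S := m.+1 ^ N.
pose Z := S * m.+1 + (n + 2) * (m + 2) * (m + 2).
have Nn : N <= n by rewrite /N geq_minl.
have Nm : N <= m by rewrite /N geq_minr.
have N0 : 0 < N by rewrite /N leq_min n0.
have /andP[Lm mK] := trunc_log_bounds (isT : 1 < 2) m0.
have Km : K <= m by apply: leq_trans Lm; apply: ltn_expl.
have c1 : N * m * m <= (n + 2) * (m + 2) * (m + 2).
  by apply: leq_mul; [apply: leq_mul|]; lia.
have Z_input : m + n + n * m + N < Z.
  have : (n + 2) * (m + 2) * 2 <= (n + 2) * (m + 2) * (m + 2) by rewrite leq_mul2l; lia.
  by rewrite /Z; lia.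
have Z_table : K * S <= Z.
  by apply: leq_trans (leq_addr _ _); rewrite mulnC leq_mul2l; apply/orP; right; lia.
have ex (t g : nat) : g < m -> m <= t ->
    avail m N (position_rank pi sigma) (iter t (next_code m N (position_rank pi sigma)) 0) g = false.
  by move=> gm; exact: (rounds_exhaust pi_pref n0 (position_rankE pi sigma) (Ordinal gm)).
have [o [Ho _ _ [Hout Hw Hd]]] := wp_main pi_pref pi_ties m0 N0 Nn Nm (erefl S) mK (ltn0Sn L)
  Z_input (leq_trans c1 (leq_addl _ _)) (leq_addr _ _) Z_table
  (word_capacity n0 Nn (ltn0Sn L) mK hw) ex (erefl _) Lm (erefl Z) E0 E1 (conj Is It).
exists (tick 1 o); split.
- exact: (@exec_Call _ _ _ _ _ _ 0 main_proc).
- move=> i g; have [t [j [[h1 h2 h3 h4 h5] /= ->]]] := Hout g (ltn_ord g).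
  rewrite (owner_round_robin pi_pref n0 (position_rankE pi sigma) h1 h2 h3 h4 h5).
  by rewrite eq_sym.
move=> m2 /=; have L0 : 0 < L by rewrite /L trunc_log_gt0.
split.
  have h1 : K * N * K <= (L * 2) * n * (L * 2) by rewrite !leq_mul //; lia.
  (* The depth obtained so far is linear in [n]; it is relaxed here to the stated square. *)
  have h2 : n * 1 <= n * n by rewrite leq_mul2l n0 orbT.
  have h3 := leq_mul h2 (leqnn (L * L)).
  have h4 : 1 <= n * n * (L * L) by rewrite !muln_gt0 n0 L0.
  rewrite add1n; rewrite -!mulnn; lia.
have h1 : S <= 8 * m ^ n.
  apply: leq_trans (expnS_base m0 Nm) _; rewrite leq_mul2l leq_exp2l //.
have h2 := leq_mul h1 (leq_mul Nn (leqnn m)).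
have h3 : 1 <= n * (m * m ^ n) by rewrite !muln_gt0 n0 m0 expn_gt0 m0.
rewrite add1n expnS; lia.
Qed.
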